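(* There exist absolute constants $c>0$ and $t_0$ such that for all integers $t\ge t_0$ and all integers $1\le s\le t$, \[ r_{K_s}(4,t)\ \ge\ \binom{\lfloor c\, t^3/\log^4 t\rfloor}{s}. \] In particular, there is a function $\varepsilon(t)\to 0$ as $t\to\infty$ (not depending on $s$) such that for all $1\le s\le t$, \[ \binom{r(4,t)}{s}^{1-\varepsilon(t)}\ \le\ r_{K_s}(4,t)\ \le\ \binom{r(4,t)}{s}, \] i.e. $r_{K_s}(4,t)=\binom{r(4,t)}{s}^{1-o(1)}$.
   Context: A graph $G$ is $(t_1,t_2)$-Ramsey if every coloring of the edges of $G$ with red and blue contains either a red copy of $K_{t_1}$ or a blue copy of $K_{t_2}$. The Ramsey number $r(t_1,t_2)$ is the smallest $n$ such that $K_n$ is $(t_1,t_2)$-Ramsey. For a graph $F$, the $F$-Ramsey number $r_F(t_1,t_2)$ is the minimum, over all $(t_1,t_2)$-Ramsey graphs $G$, of the number of (not necessarily induced) copies of $F$ in $G$. Thus $r_{K_s}(t_1,t_2)$ is the minimum number of $s$-cliques in a $(t_1,t_2)$-Ramsey graph. *)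

(* Defs.v *)
From mathcomp Require Import all_boot.
From mathcomp Require Import boolp.

Set Implicit Arguments.
Unset Strict Implicit.
Unset Printing Implicit Defensive.

Record sgraph := SGraph {
  vertex :> finType;
  adj : rel vertex;
  adj_sym : symmetric adj;
  adj_irrefl : irreflexive adj
}.

Definition edges (G : sgraph) : {set {set G}} :=
  [set [set u.1; u.2] | u : G * G & adj u.1 u.2].

Lemma neq_sym (T : eqType) : symmetric (fun x y : T => x != y).
Proof. by move=> x y; rewrite eq_sym. Qed.

Lemma neq_irrefl (T : eqType) : irreflexive (fun x y : T => x != y).
Proof. by move=> x; rewrite eqxx. Qed.

Definition complete_graph (n : nat) : sgraph :=
  SGraph (@neq_sym 'I_n) (@neq_irrefl 'I_n).

Definition is_embedding (F G : sgraph) (f : {ffun F -> G}) : bool :=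
  injectiveb f && [forall x, forall y, adj x y ==> adj (f x) (f y)].

(* A copy of F in G is a subgraph of G, not necessarily induced, that is
   isomorphic to F; it is encoded as the pair (vertex set, edge set).
   Embeddings of F with the same image give the same copy. *)
Definition copies (F G : sgraph) : {set {set G} * {set {set G}}} :=
  [set (f @: [set: F], [set f @: (e : {set F}) | e in edges F])
    | f : {ffun F -> G} & is_embedding f].

Lemma card_copies_complete (s : nat) (G : sgraph) :
  #|copies (complete_graph s) G| =
  #|[set A : {set G} | (#|A| == s) &&
      [forall x in A, forall y in A, (x != y) ==> adj x y]]|.
Proof.
pose pairs (A : {set G}) := [set [set u.1; u.2] | u in
  [set u : G * G | [&& u.1 \in A, u.2 \in A & u.1 != u.2]]].
have inj : injective (fun A => (A, pairs A)) by move=> A B [].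
rewrite -(card_imset _ inj); apply: eq_card => p.
have imE (f : {ffun complete_graph s -> G}) : injective f ->
    [set f @: (e : {set _}) | e in edges (complete_graph s)]
      = pairs (f @: setT).
  move=> fI; apply/setP=> e; apply/imsetP/imsetP.
    move=> [_ /imsetP[[i j] + ->] ->]; rewrite inE /= => neq.
    exists (f i, f j); last by rewrite imsetU !imset_set1.
    by rewrite inE /= !imset_f //= (inj_eq fI).
  move=> [[x y]]; rewrite inE /= => /and3P[/imsetP[i _ ->] /imsetP[j _ ->]].
  rewrite (inj_eq fI) => neq ->; exists [set i; j].
    by apply/imsetP; exists (i, j); rewrite ?inE.
  by rewrite imsetU !imset_set1.
apply/imsetP/imsetP.
  move=> [f]; rewrite inE => /andP[/injectiveP fI /forallP fH] ->.
  exists (f @: setT); last by rewrite imE.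
  rewrite inE card_imset // cardsT card_ord eqxx /=.
  apply/forallP=> x; apply/implyP=> /imsetP[i _ ->].
  apply/forallP=> y; apply/implyP=> /imsetP[j _ ->].
  rewrite (inj_eq fI); exact: (forallP (fH i) j).
move=> [A]; rewrite inE => /andP[/eqP cA /forallP AH] ->.
pose f := [ffun i : complete_graph s =>
  enum_val (cast_ord (esym cA) i) : G].
have fI : injective f.
  by move=> i j; rewrite !ffunE => /enum_val_inj /cast_ord_inj.
have fA i : f i \in A by rewrite ffunE; apply: enum_valP.
have imA : f @: setT = A.
  apply/eqP; rewrite eqEcard card_imset // cardsT card_ord cA leqnn andbT.
  by apply/subsetP=> _ /imsetP[i _ ->].
exists f; last by rewrite imE // imA.
rewrite inE; apply/andP; split; first exact/injectiveP.
apply/forallP=> i; apply/forallP=> j; apply/implyP=> neq.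
have /implyP/(_ (fA i))/forallP/(_ (f j))/implyP/(_ (fA j)) := AH (f i).
by rewrite (inj_eq fI) => /implyP; apply.
Qed.

(* [true] is red and [false] is blue; the values of the colouring on sets of
   vertices that are not edges of G are never used. *)
Definition coloring (G : sgraph) : finType := {ffun {set G} -> bool}.

Section ColorClass.
Variables (G : sgraph) (c : coloring G) (b : bool).

Definition class_adj : rel G :=
  fun x y => adj x y && (c [set x; y] == b).

Lemma class_adj_sym : symmetric class_adj.
Proof. by move=> x y; rewrite /class_adj adj_sym setUC. Qed.

Lemma class_adj_irrefl : irreflexive class_adj.
Proof. by move=> x; rewrite /class_adj adj_irrefl. Qed.

Definition color_class : sgraph := SGraph class_adj_sym class_adj_irrefl.

End ColorClass.

Definition is_ramsey (t1 t2 : nat) (G : sgraph) : bool :=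
  [forall c : coloring G,
     (copies (complete_graph t1) (color_class c true) != set0)
  || (copies (complete_graph t2) (color_class c false) != set0)].

(* Makes the minima defining [ramsey] and [F_ramsey] range over
   nonempty sets. *)

Definition mono (T : finType) (c : {set T} -> bool) b (B : {set T}) :=
  {in B &, forall x y, x != y -> c [set x; y] = b}.

Lemma ramsey_sets (t1 t2 : nat) : exists n, forall (T : finType)
    (c : {set T} -> bool) (A : {set T}), n <= #|A| ->
  (exists B : {set T}, [/\ B \subset A, #|B| = t1 & mono c true B]) \/
  (exists B : {set T}, [/\ B \subset A, #|B| = t2 & mono c false B]).
Proof.
have mono0 (T : finType) c b : mono c b (set0 : {set T}).
  by move=> x y; rewrite inE.
elim: t1 t2 => [|t1 IH1] t2.
  by exists 0 => T c A _; left; exists set0; rewrite sub0set cards0.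
elim: t2 => [|t2 IH2].
  by exists 0 => T c A _; right; exists set0; rewrite sub0set cards0.
have [n1 H1] := IH1 t2.+1; have [n2 H2] := IH2.
exists (n1 + n2).+1 => T c A leA.
have /card_gt0P[v vA] : 0 < #|A| by apply: leq_trans leA.
pose N b := [set x in A :\ v | c [set v; x] == b].
have sN b : N b \subset A.
  by apply/subsetP=> x; rewrite !inE => /andP[/andP[]].
have ext b (B : {set T}) t : B \subset N b -> #|B| = t -> mono c b B ->
    [/\ v |: B \subset A, #|v |: B| = t.+1 & mono c b (v |: B)].
  move=> sB cB mB.
  have colv x : x \in B -> c [set v; x] = b.
    by move=> /(subsetP sB); rewrite !inE => /andP[_ /eqP].
  split.
  - by rewrite subUset sub1set vA (subset_trans sB).
  - rewrite cardsU1 cB; case: (boolP (v \in B)) => // /(subsetP sB).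
    by rewrite !inE eqxx.
  - move=> x y; rewrite !inE => /orP[/eqP->|xB] /orP[/eqP->|yB] neq.
    + by rewrite eqxx in neq.
    + exact: colv.
    + by rewrite setUC; apply: colv.
    + exact: mB.
have cN : #|A| = (#|N true| + #|N false|).+1.
  rewrite (cardsD1 v) vA; congr _.+1.
  rewrite -(cardsID [set x | c [set v; x]] (A :\ v)).
  congr (_ + _); apply: eq_card => x; rewrite !inE.
    by rewrite eqb_id.
  by rewrite eqbF_neg andbC.
have [le1|lt1] := leqP n1 #|N true|.
  have [[B [sB cB mB]]|[B [sB cB mB]]] := H1 T c _ le1.
    by left; exists (v |: B); apply: ext.
  by right; exists B; split=> //; apply: subset_trans (sN true).
have le2 : n2 <= #|N false|.
  move: leA; rewrite cN ltnS => leA; rewrite -(leq_add2l n1).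
  by apply: leq_trans leA _; rewrite leq_add2r ltnW.
have [[B [sB cB mB]]|[B [sB cB mB]]] := H2 T c _ le2.
  by left; exists B; split=> //; apply: subset_trans (sN false).
by right; exists (v |: B); apply: ext.
Qed.

Lemma mono_copies n (c : coloring (complete_graph n)) b t (B : {set 'I_n}) :
  #|B| = t -> mono c b B ->
  copies (complete_graph t) (color_class c b) != set0.
Proof.
move=> cB mB; apply/set0Pn.
pose f := [ffun i : complete_graph t =>
  (enum_val (cast_ord (esym cB) i) : color_class c b)].
have fI : injective f.
  by move=> i j; rewrite !ffunE => /enum_val_inj /cast_ord_inj.
exists (f @: setT, [set f @: (e : {set _}) | e in edges (complete_graph t)]).
apply/imsetP; exists f => //; rewrite inE; apply/andP; split.
  exact/injectiveP.
apply/forallP=> i; apply/forallP=> j; apply/implyP=> neq /=.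
have neqf : f i != f j by rewrite (inj_eq fI).
apply/andP; split=> //; apply/eqP; apply: mB => //.
  by rewrite ffunE; apply: enum_valP.
by rewrite ffunE; apply: enum_valP.
Qed.

Lemma ramsey_complete (t1 t2 : nat) :
  exists n, is_ramsey t1 t2 (complete_graph n).
Proof.
have [n Hn] := ramsey_sets t1 t2; exists n; apply/forallP => c.
have [|[B [_ cB mB]]|[B [_ cB mB]]] := Hn 'I_n c setT.
- by rewrite cardsT card_ord.
- by rewrite (mono_copies cB mB).
- by rewrite (mono_copies cB mB) orbT.
Qed.

Definition ramsey (t1 t2 : nat) : nat := ex_minn (ramsey_complete t1 t2).

Definition ramsey_count (F : sgraph) (t1 t2 : nat) : pred nat :=
  fun m => `[< exists G : sgraph, is_ramsey t1 t2 G /\ #|copies F G| = m >].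

Lemma ramsey_count_ex (F : sgraph) (t1 t2 : nat) :
  exists m, ramsey_count F t1 t2 m.
Proof.
have [n Hn] := ramsey_complete t1 t2.
exists #|copies F (complete_graph n)|.
by apply/asboolP; exists (complete_graph n).
Qed.

Definition F_ramsey (F : sgraph) (t1 t2 : nat) : nat :=
  ex_minn (ramsey_count_ex F t1 t2).

(* Main.v *)
Require Import Defs.
From mathcomp Require Import all_boot all_order all_algebra all_field.
From mathcomp Require Import boolp zify ring lra.

(* Let H be a K_4-free graph on n vertices.  If G is (4,t)-Ramsey then every
   map f : V(G) -> V(H) sends some t-clique of G to an independent set of H,
   since otherwise colouring xy red iff f x and f y are adjacent avoids both a
   red K_4 and a blue K_t.  Averaging over f, the number of t-cliques of G is
   at least the inverse of the probability that a random t-tuple of vertices of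
   H is independent.  For H we take the graph of Mattheus and Verstraete: the
   vertices are the ~q^4 secants of the Hermitian curve over F_{q^2}, and for
   each of the q^3 points of the curve the clique of secants through it is
   replaced by a random complete bipartite graph.  H is K_4-free because the
   curve contains no O'Nan configuration, and all sets of at least 32 q^2
   secants span many edges, so a Kleitman-Winston argument shows that the
   probability is at most (O(1) / q^2)^t as soon as t >= 512 q (log q)^2.  Hence
   G has at least (t q^2 / 512)^t ordered t-cliques.  The numbers w_t of ordered
   t-cliques satisfy w_{t+1}^t <= w_t^{t+1}, which passes to all s <= t.  The
   second part also uses the Erdos-Szekeres bound r(4,t) = O(t^3). *)

Set Implicit Arguments.
Unset Strict Implicit.
Unset Printing Implicit Defensive.

(** * Counting cliques *)

Section Cliques.
Variables (T : finType) (e : rel T).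

Definition cliques (S : {set T}) (t : nat) : {set {set T}} :=
  [set A : {set T} | [&& A \subset S, #|A| == t &
     [forall x in A, forall y in A, (x != y) ==> e x y]]].

Lemma cliquesP (S : {set T}) t (A : {set T}) :
  reflect [/\ A \subset S, #|A| = t & {in A &, forall x y, x != y -> e x y}]
          (A \in cliques S t).
Proof.
rewrite inE; apply: (iffP and3P) => -[sA cA eA]; split=> //.
- exact/eqP.
- move=> x y xA yA; move/forall_inP: eA => /(_ x xA) /forall_inP.
  by move=> /(_ y yA) /implyP.
- exact/eqP.
- by apply/forall_inP => x xA; apply/forall_inP => y yA; apply/implyP; apply: eA.
Qed.

Hypotheses (e_sym : symmetric e) (e_irr : irreflexive e).

Lemma card_cliques_vertex (S : {set T}) t v : v \in S ->
  #|[set B in cliques S t.+1 | v \in B]| =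
  #|cliques (S :&: [set y | e v y]) t|.
Proof.
move=> vS; pose N := S :&: [set y | e v y].
have vN : v \notin N by rewrite !inE e_irr andbF.
have vA A : A \in cliques N t -> v \notin A.
  by case/cliquesP=> sA _ _; apply: contra vN; apply: subsetP.
rewrite -(card_in_imset (f := fun A => v |: A) (D := cliques N t)); last first.
  by move=> A B /vA vA' /vA vB' /= E; rewrite -(setU1K vA') E setU1K.
apply: eq_card => B; rewrite inE; apply/andP/imsetP.
- case=> /cliquesP[sB cB eB] vB; exists (B :\ v); last by rewrite setD1K.
  apply/cliquesP; split.
  + apply/subsetP=> x; rewrite !inE => /andP[xv xB].
    by rewrite (subsetP sB) //= eB // eq_sym.
  + by move: cB; rewrite (cardsD1 v) vB => -[].
  + by move=> x y /setD1P[_ xB] /setD1P[_ yB]; apply: eB.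
- case=> A /[dup] /vA nvA /cliquesP[sA cA eA] ->; split; last exact: setU11.
  have AN x : x \in A -> e v x by move=> /(subsetP sA); rewrite !inE => /andP[].
  apply/cliquesP; split.
  + rewrite subUset sub1set vS /=; apply: subset_trans sA _; exact: subsetIl.
  + by rewrite cardsU1 nvA cA.
  + move=> x y /setU1P[->|xA] /setU1P[->|yA]; rewrite ?eqxx // => ne.
    * exact: AN.
    * by rewrite e_sym AN.
    * exact: eA.
Qed.

Lemma sum_card_cliques (S : {set T}) t :
  \sum_(v in S) #|cliques (S :&: [set y | e v y]) t| =
  t.+1 * #|cliques S t.+1|.
Proof.
rewrite mulnC -sum_nat_const.
transitivity (\sum_(B in cliques S t.+1) \sum_(v in S | v \in B) 1).
  rewrite [RHS](exchange_big_dep (mem S)) => [|B v _ /andP[] //].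
  apply: eq_bigr => v vS.
  rewrite -card_cliques_vertex // -sum1_card.
  by apply: eq_bigl => B; rewrite inE vS.
apply: eq_bigr => B /cliquesP[sB cB _]; rewrite -cB -sum1_card.
by apply: eq_bigl => v; apply: andb_idl; apply: subsetP.
Qed.

End Cliques.

(** With real p-th roots this would be the sum of [a i <= A ^ (1/p) * b i]. To stay in [nat],
    binomial expansions are compared term by term, each term being raised to the power [p]. *)
Lemma leq_sum_expn (I : finType) (P : pred I) (p A : nat) (a b : I -> nat) :
  0 < p -> (forall i, P i -> a i ^ p <= A * b i ^ p) ->
  (\sum_(i | P i) a i) ^ p <= A * (\sum_(i | P i) b i) ^ p.
Proof.
move=> p0 ab; apply: (big_rec2 (fun x y => x ^ p <= A * y ^ p)).
  by rewrite exp0n // muln0.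
move=> i y1 y2 /ab Hi Hy.
rewrite addnC [b i + _]addnC !expnDn big_distrr /=; apply: leq_sum => j _.
have jp : j <= p by rewrite -ltnS.
rewrite [A * _]mulnCA leq_mul2l; apply/orP; right.
rewrite -(leq_exp2r _ _ p0) !expnMn -!expnM ![_ * p]mulnC !expnM.
have -> : A ^ p = A ^ (p - j) * A ^ j by rewrite -expnD subnK.
rewrite mulnACA -!expnMn; apply: leq_mul.
  by case: (p - j) => [//|m]; rewrite leq_exp2r.
by case: (nat_of_ord j) => [//|m]; rewrite leq_exp2r.
Qed.

Lemma ffact_leq_expn n m : n ^_ m <= n ^ m.
Proof.
elim: m => [|m IH]; first by rewrite ffactn0.
by rewrite ffactnSr expnSr leq_mul // leq_subr.
Qed.

Section CliqueCounts.
Variables (T : finType) (e : rel T).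
Hypotheses (e_sym : symmetric e) (e_irr : irreflexive e).
Implicit Type S : {set T}.

Local Notation w t S := (t`! * #|cliques e S t|).

Lemma cliques0 S : cliques e S 0 = [set set0].
Proof.
apply/setP=> A; rewrite in_set1; apply/cliquesP/eqP => [[_ /eqP + _]|->].
  by rewrite cards_eq0 => /eqP.
by split; rewrite ?sub0set ?cards0 // => x y; rewrite inE.
Qed.

(* If [a_v] and [b_v] count the ordered t.+1- and t-cliques in the
   neighbourhood of v, then [a_v] is at most the number [W] of ordered
   t.+1-cliques and [a_v ^ t <= b_v ^ t.+1] by induction, so
   [a_v ^ t.+1 <= W * b_v ^ t.+1]. *)
Lemma card_cliques_loomis_whitney t S : w t.+1 S ^ t <= w t S ^ t.+1.
Proof.
elim: t S => [|t IH] S.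
  by rewrite cliques0 cards1.
have wS u : w u.+1 S = \sum_(v in S) w u (S :&: [set y | e v y]).
  by rewrite -big_distrr /= (sum_card_cliques e_sym e_irr) mulnA [u`! * _]mulnC.
rewrite [w t.+2 S]wS [_ ^ t.+2]expnS {2}[w t.+1 S]wS.
apply: leq_sum_expn => // v vS; rewrite expnS leq_mul ?IH //.
rewrite leq_mul2l; apply/orP; right; apply/subset_leq_card/subsetP => B.
case/cliquesP=> sB cB eB; apply/cliquesP; split=> //.
exact: subset_trans sB (subsetIl _ _).
Qed.

(** By [card_cliques_loomis_whitney], the t-th root of the number of ordered t-cliques does not
    increase with [t]. *)
Lemma cliques_pow N t s S :
  0 < s <= t -> N ^ t <= w t S -> N ^ s <= w s S.
Proof.
elim: t => [|t IH]; first by case: s.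
case/andP=> s0; rewrite leq_eqVlt => /predU1P[->//|]; rewrite ltnS => st H.
have t0 : 0 < t by apply: leq_trans st.
apply: IH; first by rewrite s0.
rewrite -(leq_exp2r _ _ (ltn0Sn t)) -expnM mulnC expnM.
by apply: leq_trans (card_cliques_loomis_whitney t S); rewrite leq_exp2r.
Qed.

Lemma bin_card_cliques N t s S :
  0 < s <= t -> N ^ t <= w t S -> 'C(N, s) <= #|cliques e S s|.
Proof.
move=> st /(cliques_pow st) H; rewrite -(leq_pmul2l (fact_gt0 s)) mulnC.
by rewrite bin_ffact; apply: leq_trans H; apply: ffact_leq_expn.
Qed.
End CliqueCounts.

(** * Random homomorphisms and containers *)

Lemma card_copies_cliques s (G : sgraph) :
  #|copies (complete_graph s) G| = #|cliques (@adj G) setT s|.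
Proof.
rewrite card_copies_complete; apply: eq_card => A.
by rewrite !inE subsetT.
Qed.

Lemma color_class_clique t (G : sgraph) (c : coloring G) b :
  copies (complete_graph t) (color_class c b) != set0 ->
  exists2 A, A \in cliques (@adj G) setT t &
    {in A &, forall x y : G, x != y -> c [set x; y] = b}.
Proof.
rewrite -card_gt0 card_copies_cliques => /card_gt0P[A /cliquesP[_ cA eA]].
exists A; first by apply/cliquesP; split; rewrite ?subsetT // => x y xA yA
  /(eA x y xA yA)/andP[].
by move=> x y xA yA /(eA x y xA yA)/andP[_ /eqP].
Qed.

(** The map [f] need not be injective: for irreflexive [e] a repeated value already gives a
    non-adjacent pair. *)
Definition clique4_free (L : finType) (e : rel L) :=
  forall f : 'I_4 -> L, [exists i, exists j, (i != j) && ~~ e (f i) (f j)].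

Section RandomColouring.
Variables (G : sgraph) (L : finType) (e : rel L) (t : nat).
Hypotheses (e_sym : symmetric e) (e_irr : irreflexive e).

Definition hom_indep (A : {set G}) : {set {ffun G -> L}} :=
  [set f : {ffun G -> L} | [forall x in A, forall y in A, ~~ e (f x) (f y)]].

Lemma ramsey_hom_indep (f : {ffun G -> L}) :
  clique4_free e -> is_ramsey 4 t G ->
  exists2 A, A \in cliques (@adj G) setT t & f \in hom_indep A.
Proof.
(* Colours are given to sets, so a set is red when two of its elements have adjacent images;
   irreflexivity of [e] makes these elements distinct. *)
move=> e4 /forallP/(_ [ffun E : {set G} =>
  [exists x in E, exists y in E, e (f x) (f y)]]) => /orP[]
  /color_class_clique[A cA colA].
  case/cliquesP: (cA) => _ A4 _.
  have /existsP[i /existsP[j /andP[ij /negP[]]]] :=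
    e4 (fun i => f (enum_val (cast_ord (esym A4) i))).
  set x := enum_val _; set y := enum_val _.
  have xy : x != y by rewrite (inj_eq enum_val_inj) (inj_eq (@cast_ord_inj _ _ _)).
  have := colA x y (enum_valP _) (enum_valP _) xy; rewrite ffunE.
  case/exists_inP=> u + /exists_inP[v].
  by rewrite !inE => /orP[]/eqP-> /orP[]/eqP->; rewrite ?e_irr // e_sym.
exists A => //; rewrite inE; apply/forall_inP => x xA; apply/forall_inP => y yA.
have [->|xy] := eqVneq x y; first by rewrite e_irr.
have := colA x y xA yA xy; rewrite ffunE => /negbT; apply: contra => exy.
apply/exists_inP; exists x; first by rewrite !inE eqxx.
by apply/exists_inP; exists y => //; rewrite !inE eqxx orbT.
Qed.

Definition homs_into (A : {set G}) (X : {set L}) : {set {ffun G -> L}} :=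
  [set f : {ffun G -> L} in hom_indep A | f @: A \subset X].

Lemma card_homs_into (A : {set G}) (X : {set L}) :
  #|homs_into A X| <= #|X| ^ #|A| * #|L| ^ (#|G| - #|A|).
Proof.
pose F x : pred L := fun u => (x \in A) ==> (u \in X).
apply: (@leq_trans #|family F|).
  apply/subset_leq_card/subsetP => f; rewrite !inE => /andP[_ /subsetP fX].
  by apply/forallP => x; apply/implyP => xA; exact/fX/imset_f.
rewrite card_family.
have -> (I : finType) (h : I -> nat) :
  foldr muln 1 [seq h x | x : I] = \prod_x h x by rewrite foldrE big_map big_enum.
rewrite (bigID (mem A)) /= (eq_bigr (fun=> #|X|)); last first.
  by move=> x /= xA; apply: eq_card => u; rewrite unfold_in xA.
rewrite [X in _ * X](eq_bigr (fun=> #|L|)); last first.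
  by move=> x /= xA; apply: eq_card => u; rewrite unfold_in (negbTE xA).
by rewrite !prod_nat_const leq_mul2l -(cardC A) addKn leqnn orbT.
Qed.

(* Kleitman-Winston: a map hitting a vertex v of large degree in X avoids the
   neighbours of v, so it lands in a set smaller by the factor 1 - 1/D; this
   can happen at most h times before the size drops below M. *)
Lemma card_homs_container (M D h : nat) (A : {set G}) (X : {set L}) :
  (forall Y : {set L}, M < #|Y| ->
     exists2 v, v \in Y & #|Y| <= D * #|Y :&: [set u | e v u]|) ->
  #|X| * D.-1 ^ h <= M * D ^ h ->
  #|homs_into A X| <= #|X|.+1 ^ h * (M ^ #|A| * #|L| ^ (#|G| - #|A|)).
Proof.
move=> dens; move: {2}#|X| (leqnn #|X|) => m.
elim: m h X => [|m IH] h X Xm hX.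
  apply: leq_trans (card_homs_into A X) _.
  rewrite -[X in X <= _]mul1n leq_mul ?expn_gt0 // leq_mul2r; apply/orP; right.
  case: #|A| => [//|a]; rewrite leq_exp2r //; lia.
have [XM|MX] := leqP #|X| M.
  apply: leq_trans (card_homs_into A X) _.
  rewrite -[X in X <= _]mul1n leq_mul ?expn_gt0 // leq_mul2r; apply/orP; right.
  by case: #|A| => [//|a]; rewrite leq_exp2r //; lia.
have [v vX vD] := dens X MX.
have D0 : 0 < D by case: D vD {IH dens hX} => //; lia.
case: h hX => [|h] hX; first by move: hX; rewrite !expn0 !muln1; lia.
set C := M ^ _ * _.
have cXv : #|X| = #|X :\ v|.+1 by rewrite (cardsD1 v) vX.
have cXN : #|X| = #|X :&: [set u | e v u]| + #|X :\: [set u | e v u]|.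
  by rewrite cardsID.
set N := [set u | e v u] in vD cXN.
have N0 : 0 < #|X :&: N|.
  by case: #|X :&: N| vD => //; rewrite muln0; lia.
have H1 : #|homs_into A (X :\ v)| <= #|X :\ v|.+1 ^ h.+1 * C.
  apply: IH; first by lia.
  by apply: leq_trans hX; rewrite leq_mul2r; apply/orP; right; lia.
have H2 : #|homs_into A (X :\: N)| <= #|X :\: N|.+1 ^ h * C.
  apply: IH; first by lia.
  rewrite -(leq_pmul2l D0) mulnA [D * (M * _)]mulnCA -expnS.
  apply: leq_trans hX; rewrite expnS mulnA leq_mul2r; apply/orP; right.
  by move: vD D0; rewrite cXN; case: (D) => //= d; nia.
(* Either [v] is not a value of [f] on [A], or independence keeps these values outside [N], which
   uses up one unit of [h]. *)
have sub : homs_into A X \subset homs_into A (X :\ v) :|: homs_into A (X :\: N).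
  apply/subsetP => f; rewrite !inE => /andP[fA /subsetP fX]; rewrite fA /=.
  have [/imsetP[x xA vx]|vf] := boolP (v \in f @: A); apply/orP; [right|left].
    apply/subsetP => _ /imsetP[y yA ->]; rewrite !inE fX ?imset_f // andbT vx.
    by move/forall_inP: fA => /(_ x xA)/forall_inP/(_ y yA).
  apply/subsetP => u uf; rewrite !inE fX // andbT; apply: contraNneq vf.
  by move=> <-.
apply: leq_trans (subset_leq_card sub) _; apply: leq_trans (leq_card_setU _ _) _.
apply: leq_trans (leq_add H1 H2) _; rewrite -mulnDl leq_mul2r; apply/orP; right.
rewrite cXv.
have le1 : #|X :\: N|.+1 ^ h <= #|X :\ v|.+2 ^ h.
  case: (h) => // h'; rewrite leq_exp2r //; lia.
have le2 : #|X :\ v|.+1 ^ h <= #|X :\ v|.+2 ^ h.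
  case: (h) => // h'; rewrite leq_exp2r //; lia.
rewrite [_.+1 ^ h.+1]expnS [_.+2 ^ h.+1]expnS [X in _ <= X * _]lock mulSn.
rewrite -lock [_.+2 * _]mulSn; nia.
Qed.

Lemma ramsey_card_cliques (M D h : nat) :
  clique4_free e -> is_ramsey 4 t G -> 0 < #|L| ->
  (forall Y : {set L}, M < #|Y| ->
     exists2 v, v \in Y & #|Y| <= D * #|Y :&: [set u | e v u]|) ->
  #|L| * D.-1 ^ h <= M * D ^ h ->
  #|L| ^ t <= #|cliques (@adj G) setT t| * (#|L|.+1 ^ h * M ^ t).
Proof.
move=> e4 rG L0 dens hM.
pose Q := cliques (@adj G) setT t.
have HA A : A \in Q ->
    #|hom_indep A| <= #|L|.+1 ^ h * (M ^ t * #|L| ^ (#|G| - t)).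
  case/cliquesP=> _ <- _; have := card_homs_container A (X := setT) dens.
  rewrite cardsT => /(_ h hM); apply: leq_trans.
  by apply/subset_leq_card/subsetP => f fA; rewrite inE fA subsetT.
have H : #|L| ^ #|G| <= \sum_(A in Q) #|hom_indep A|.
  under eq_bigr => A _ do rewrite -sum1_card big_mkcond.
  rewrite exchange_big /= -card_ffun -sum1_card; apply: leq_sum => f _.
  have [A AQ fA] := ramsey_hom_indep f e4 rG.
  by rewrite (bigD1 A) //= fA.
have {}HA := leq_trans H (leq_sum _ HA).
(* A t-clique exists, so [t <= #|G|] and the power with exponent [#|G| - t] can be cancelled. *)
have [A AQ] : exists A, A \in Q.
  apply/set0Pn; apply: contraTneq HA => ->; rewrite big_set0 -ltnNge.
  by rewrite expn_gt0 L0.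
have tG : t <= #|G|.
  by case/cliquesP: AQ => _ <- _; rewrite -cardsT subset_leq_card ?subsetT.
rewrite sum_nat_const in HA; move: HA.
rewrite -{1}(subnKC tG) expnD !mulnA leq_pmul2r //.
by rewrite expn_gt0 L0.
Qed.
End RandomColouring.

(** * Random bipartitions of the pencils of a partial linear space *)

Import Order.TTheory GRing.Theory Num.Theory.

Section Unbalanced.
Variables (R : realFieldType) (L : finType).
Implicit Types (f : {ffun L -> bool}) (S : {set L}).

Definition colour_count f S c := #|[set l in S | f l == c]|.

Definition unbalanced f S :=
  [exists c, 8 * colour_count f S c < #|S|].

Lemma colour_countD f S : colour_count f S true + colour_count f S false = #|S|.
Proof.
rewrite -(cardsID [set l | f l] S); congr (_ + _); apply: eq_card => l;
  rewrite !inE ?eqb_id // eqbF_neg andbC //.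
Qed.

(** Each colour has a share of at least 1/8, so the product of the two shares is at least 7/64, more
    than 1/16. *)
Lemma balanced_sqr f S : ~~ unbalanced f S ->
  #|S| ^ 2 <= 16 * (colour_count f S true * colour_count f S false).
Proof.
rewrite negb_exists => /forallP H; have := H true; have := H false.
rewrite -leqNgt -leqNgt -(colour_countD f S).
by move: (colour_count _ _ _) (colour_count _ _ _) => a b; nia.
Qed.

Local Open Scope ring_scope.

(* Chernoff bound; the weight (3/2) ^ (#|S| - 8 a) is at least 1 when the
   colour c is used a <= #|S| / 8 times. *)
Lemma sum_unbalanced S :
  \sum_f (5 / 4 : R) ^+ (if unbalanced f S then #|S| else 0)
    <= 3 * 2 ^+ #|L|.
Proof.
pose W c f : R := \prod_(l : L) (if l \in S then
  15 / 8 * (if f l == c then (2 / 3) ^+ 8 else 1) else 1).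
have WE c f : W c f =
    (5 / 4 : R) ^+ #|S| * ((3 / 2 : R) ^+ #|S| * (2 / 3 : R) ^+ (8 * colour_count f S c)).
  rewrite /W -big_mkcond big_split /= prodr_const mulrA -exprMn.
  congr (_ ^+ _ * _); first by lra.
  rewrite -big_mkcondr exprM prodr_const; congr (_ ^+ _).
  by apply: eq_card => l; rewrite !inE.
have W0 c f : 0 <= W c f.
  by rewrite WE !mulr_ge0 ?exprn_ge0 //; lra.
have W1 c f : (8 * colour_count f S c < #|S|)%N -> (5 / 4 : R) ^+ #|S| <= W c f.
  move=> /ltnW le; rewrite WE ler_peMr ?exprn_ge0 //; first by lra.
  rewrite -(subnK le) exprD -mulrA -exprMn.
  have -> : 3 / 2 * (2 / 3) = 1 :> R by lra.
  by rewrite expr1n mulr1 exprn_ege1 //; lra.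
have sumW c : \sum_f W c f <= 2 ^+ #|L|.
  rewrite /W -(bigA_distr_bigA (fun l (b : bool) => if l \in S then
    15 / 8 * (if b == c then (2 / 3) ^+ 8 else 1) else 1)).
  (* An element of [S] contributes [15 / 8 * (1 + (2 / 3) ^+ 8)], about 1.95; any other element
     contributes 2. *)
  rewrite -prodr_const; apply: ler_prod => l _; rewrite big_bool /=.
  case: (l \in S); last by lra.
  by case: c; rewrite /=; lra.
apply: (@le_trans _ _ (\sum_f (1 + W true f + W false f))).
  apply: ler_sum => f _; case: ifP => [/existsP[c Hc]|_].
    have := W1 _ _ Hc; have := W0 (~~ c) f.
    by case: (c) => /=; lra.
  by have := W0 true f; have := W0 false f; lra.
rewrite !big_split /= sumr_const card_ffun card_bool natrX.
have := sumW true; have := sumW false; lra.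
Qed.

End Unbalanced.

Local Open Scope ring_scope.

(** The inequality [(1 + x) ^+ n * (1 - n x) <= 1] gives the bound 4/3. *)
Lemma expr1D_lt2 (R : realFieldType) (x : R) n : 0 <= x -> n%:R * x *+ 4 <= 1 -> (1 + x) ^+ n < 2.
Proof.
move=> x0 nx.
have H m : (1 + x) ^+ m * (1 - m%:R * x) <= 1.
  elim: m => [|m IH]; first by rewrite mul0r subr0 mulr1.
  apply: le_trans IH; rewrite exprSr -mulrA ler_wpM2l ?exprn_ge0 //; first by lra.
  have : 0 <= m%:R :> R by []; rewrite -[m.+1]addn1 natrD.
  by nra.
have := H n; have : 0 <= (1 + x) ^+ n by apply: exprn_ge0; lra.
by rewrite -mulr_natr in nx; nra.
Qed.

Local Close Scope ring_scope.

Section Design.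
Variables (R : realFieldType) (P L : finType) (inc : P -> L -> bool) (q r : nat).
Hypotheses (q16 : q = 16 * r) (r0 : 0 < r) (cP : #|P| <= q ^ 3).
Hypothesis cL : 4 * #|L| <= 2 ^ r.
Hypothesis line_size : forall l, q <= #|[set p | inc p l]|.
Implicit Types (X : {set L}) (chi : {ffun P -> {ffun L -> bool}}).

Definition pencil X p := [set l in X | inc p l].

Definition balanced_incidences chi X :=
  \sum_(p | ~~ unbalanced (chi p) (pencil X p)) #|pencil X p|.

Lemma sum_pencil X : q * #|X| <= \sum_p #|pencil X p|.
Proof.
under eq_bigr => p _ do rewrite -sum1_card.
rewrite (exchange_big_dep (mem X)) /=; last by move=> p l _; rewrite inE => /andP[].
rewrite mulnC -sum_nat_const; apply: leq_sum => l lX.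
apply: leq_trans (line_size l) _; rewrite -sum1_card leq_eqVlt; apply/orP; left.
by apply/eqP; apply: eq_bigl => p; rewrite !inE lX.
Qed.

Local Open Scope ring_scope.

(* Exponential moment: a bad colouring puts at least half of the incidences in
   unbalanced pencils, and these are independent over the points. *)
Lemma card_bad_colourings X : (32 * q ^ 2 <= #|X|)%N ->
  #|[set chi | (2 * balanced_incidences chi X < q * #|X|)%N]|%:R * 2 ^+ (r * #|X|)
    <= (2 ^+ #|L|) ^+ #|P| :> R.
Proof.
move=> mX; set B := [set _ | _].
pose wt chi : R := \prod_p (5 / 4 : R) ^+
  (if unbalanced (chi p) (pencil X p) then #|pencil X p| else 0).
have wt0 chi : 0 <= wt chi by apply: prodr_ge0 => p _; apply: exprn_ge0; lra.
(* A bad colouring puts more than [q * #|X| / 2 = 8 * r * #|X|] incidences in unbalanced pencils,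
   and [(5 / 4) ^+ 8 > 4]. *)
have four4 : 4 ^+ (r * #|X|) <= (5 / 4 : R) ^+ (8 * (r * #|X|)).
  by rewrite [leRHS]exprM; apply: lerXn2r; rewrite ?nnegrE ?exprn_ge0 //; lra.
have wtB chi : chi \in B -> 4 ^+ (r * #|X|) <= wt chi.
  rewrite inE => bad; apply: le_trans four4 _.
  rewrite /wt prodrXr ler_eXn2l; last by lra.
  rewrite -big_mkcond /=.
  have := sum_pencil X.
  rewrite (bigID (fun p => unbalanced (chi p) (pencil X p))) /=.
  move: bad; rewrite /balanced_incidences q16.
  by move: (\sum_(i | _) _)%N (\sum_(i | _) _)%N => u v; lia.
have sumwt : \sum_chi wt chi <= 3 ^+ #|P| * (2 ^+ #|L|) ^+ #|P|.
  rewrite /wt -(bigA_distr_bigA (fun p (f : {ffun L -> bool}) => (5 / 4 : R) ^+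
    (if unbalanced f (pencil X p) then #|pencil X p| else 0))).
  rewrite -exprMn -prodr_const; apply: ler_prod => p _.
  rewrite sumr_ge0 ?sum_unbalanced // => f _; apply: exprn_ge0; lra.
have H : #|B|%:R * 4 ^+ (r * #|X|) <= 3 ^+ #|P| * (2 ^+ #|L|) ^+ #|P| :> R.
  apply: le_trans sumwt; rewrite (bigID (mem B)) /= -[leLHS]addr0 lerD //.
    by rewrite mulrC mulr_natr -sumr_const; apply: ler_sum => chi; apply: wtB.
  by apply: sumr_ge0.
(* One of the two factors [2 ^+ (r * #|X|)] of [4 ^+ (r * #|X|)] pays for [3 ^+ #|P|]: from
   [q = 16 * r] and [32 * q ^ 2 <= #|X|] follows [2 * q ^ 3 <= r * #|X|]. *)
have three : 3 ^+ #|P| <= 2 ^+ (r * #|X|) :> R.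
  apply: (@le_trans _ _ (4 ^+ #|P|)); first by apply: lerXn2r; rewrite ?nnegrE; lra.
  rewrite (_ : 4 = 2 ^+ 2); last by lra.
  rewrite -exprM ler_eXn2l; last by lra.
  apply: (@leq_trans (2 * q ^ 3)); first by rewrite leq_mul2l cP.
  rewrite q16 in mX *; nia.
have p2 : 0 < 2 ^+ (r * #|X|) :> R by apply: exprn_gt0.
rewrite -(ler_pM2r p2) -mulrA -exprMn (_ : 2 * 2 = 4); last by lra.
apply: le_trans H _; rewrite mulrC ler_wpM2l // exprn_ge0 // exprn_ge0 //.
Qed.

(** Union bound: a set [X] fails with probability at most [x ^+ #|X|], where [x] is the inverse of
    [2 ^+ r]. Summed over all nonempty sets this is [(1 + x) ^+ #|L| - 1], less than 1 because
    [4 * #|L| <= 2 ^ r]. *)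
Lemma good_colouring : exists chi, forall X, (32 * q ^ 2 <= #|X|)%N ->
  (q * #|X| <= 2 * balanced_incidences chi X)%N.
Proof.
pose bad chi X := (2 * balanced_incidences chi X < q * #|X|)%N.
pose x : R := (2 ^+ r)^-1.
have x0 : 0 <= x by rewrite invr_ge0 exprn_ge0.
have nx : #|L|%:R * x *+ 4 <= 1.
  rewrite -mulr_natl mulrA ler_pdivrMr ?exprn_gt0 // mul1r -natrM -natrX ler_nat //.
case: (pickP (fun chi => [forall X : {set L}, (32 * q ^ 2 <= #|X|)%N ==> ~~ bad chi X])).
  move=> chi /forallP H; exists chi => X mX.
  by have /implyP/(_ mX) := H X; rewrite -leqNgt.
move=> none; exfalso; pose T : R := (2 ^+ #|L|) ^+ #|P|.
have T0 : 0 < T by rewrite !exprn_gt0.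
have TE : T = #|{: {ffun P -> {ffun L -> bool}}}|%:R.
  by rewrite !card_ffun card_bool !natrX.
have H1 : T <= \sum_(X : {set L} | (32 * q ^ 2 <= #|X|)%N) #|[set chi | bad chi X]|%:R.
  rewrite TE -sum1_card natr_sum.
  under [leRHS]eq_bigr => X _ do rewrite -sum1_card natr_sum big_mkcond.
  rewrite [leRHS]exchange_big /=; apply: ler_sum => chi _.
  have /negbT := none chi; rewrite negb_forall => /existsP[X].
  rewrite negb_imply negbK => /andP[mX bX].
  rewrite (bigD1 X) //= inE bX lerDl; apply: sumr_ge0 => Y _.
  by case: ifP.
have H2 : T <= \sum_(X : {set L} | X != set0) T * x ^+ #|X|.
  apply: le_trans H1 _; rewrite [leRHS](bigID (fun X : {set L} => 32 * q ^ 2 <= #|X|)%N) /=.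
  rewrite -[leLHS]addr0 lerD //; last first.
    by apply: sumr_ge0 => X _; rewrite mulr_ge0 ?exprn_ge0 // ltW.
  rewrite [leRHS](eq_bigl (fun X : {set L} => 32 * q ^ 2 <= #|X|)%N); last first.
    move=> X; apply: andb_idl; apply: contraTneq => ->; rewrite cards0 -ltnNge.
    by rewrite muln_gt0 expn_gt0 q16; lia.
  apply: ler_sum => X mX; rewrite /x exprVn -exprM ler_pdivlMr ?exprn_gt0 //.
  exact: card_bad_colourings.
have H3 : \sum_(X : {set L} | X != set0) T * x ^+ #|X| = T * ((1 + x) ^+ #|L| - 1).
  rewrite -mulr_sumr; congr (_ * _).
  have -> : (1 + x) ^+ #|L| = \prod_(l : L) (x + 1) by rewrite prodr_const addrC.
  rewrite (bigA_distr 1 +%R (fun=> x) (fun=> 1)) [in RHS](bigD1 set0) //=.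
  rewrite [X in X + _ - _]big1 ?[1 + _]addrC ?addrK; last by move=> i _; rewrite inE.
  by apply: eq_bigr => X _; rewrite -big_mkcond prodr_const.
have := expr1D_lt2 x0 nx; move: H2; rewrite H3; nra.
Qed.

End Design.

(** * Splitting each pencil into a complete bipartite graph *)

Section SplitGraph.
Variables (P L : finType) (inc : P -> L -> bool).
Variable chi : {ffun P -> {ffun L -> bool}}.
Hypothesis meet_uniq : forall l m p p', l != m ->
  inc p l -> inc p m -> inc p' l -> inc p' m -> p = p'.

Definition split_adj l m :=
  [exists p, [&& inc p l, inc p m & chi p l != chi p m]].

Lemma split_adj_sym : symmetric split_adj.
Proof.
by move=> l m; apply: eq_existsb => p; rewrite eq_sym andbCA.
Qed.

Lemma split_adj_irr : irreflexive split_adj.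
Proof.
by move=> l; apply/existsP => -[p]; rewrite eqxx !andbF.
Qed.

Lemma split_adj_neq l m : split_adj l m -> l != m.
Proof. by apply: contraTneq => ->; rewrite split_adj_irr. Qed.

(** By [meet_uniq], adjacency of two lines through [p] is witnessed by [p] itself, and two colours
    cannot separate three lines. *)
Lemma split_adj_concurrent p l m n : inc p l -> inc p m -> inc p n ->
  split_adj l m -> split_adj m n -> split_adj l n -> False.
Proof.
move=> pl pm pn.
have col u v : inc p u -> inc p v -> split_adj u v -> chi p u != chi p v.
  move=> pu pv /[dup] /split_adj_neq uv /existsP[p' /and3P[p'u p'v]].
  by rewrite (meet_uniq uv pu pv p'u p'v).
move=> /(col _ _ pl pm) + /(col _ _ pm pn) + /(col _ _ pl pn).
by case: (chi p l) (chi p m) (chi p n) => [] [] [].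
Qed.

(* O'Nan configurations are excluded: four pairwise meeting lines have three
   concurrent ones among them.  The points need not be distinct. *)
Definition onan_free := forall l1 l2 l3 l4 p23 p13 p12 p14 p24 p34,
  inc p23 l2 -> inc p23 l3 -> inc p13 l1 -> inc p13 l3 ->
  inc p12 l1 -> inc p12 l2 -> inc p14 l1 -> inc p14 l4 ->
  inc p24 l2 -> inc p24 l4 -> inc p34 l3 -> inc p34 l4 ->
  [|| inc p23 l1, inc p13 l2, inc p23 l4, inc p13 l4 | inc p12 l4].

Lemma split_adj_clique4_free : onan_free -> clique4_free split_adj.
Proof.
move=> onan f; apply: contraT; rewrite negb_exists => /forallP H.
have {}H i j : i != j -> split_adj (f i) (f j).
  move=> ij; have := H i; rewrite negb_exists => /forallP/(_ j).
  by rewrite ij /= negbK.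
pose o (i : nat) : 'I_4 := inord i.
have {}H i j : i < 4 -> j < 4 -> i != j -> split_adj (f (o i)) (f (o j)).
  by move=> i4 j4 ij; apply: H; rewrite -val_eqE /= !inordK.
have meet i j : i < 4 -> j < 4 -> i != j ->
    exists p, inc p (f (o i)) && inc p (f (o j)).
  move=> i4 j4 /(H _ _ i4 j4) /existsP[p /and3P[pi pj _]].
  by exists p; rewrite pi pj.
have [p23 /andP[h2 h3]] := meet 1 2 isT isT isT.
have [p13 /andP[h1' h3']] := meet 0 2 isT isT isT.
have [p12 /andP[h1 h2']] := meet 0 1 isT isT isT.
have [p14 /andP[k1 k4]] := meet 0 3 isT isT isT.
have [p24 /andP[k2 k4']] := meet 1 3 isT isT isT.
have [p34 /andP[k3 k4'']] := meet 2 3 isT isT isT.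
have a01 := H 0 1 isT isT isT; have a02 := H 0 2 isT isT isT.
have a03 := H 0 3 isT isT isT; have a12 := H 1 2 isT isT isT.
have a13 := H 1 3 isT isT isT; have a23 := H 2 3 isT isT isT.
have := onan _ _ _ _ _ _ _ _ _ _ h2 h3 h1' h3' h1 h2' k1 k4 k2 k4' k3 k4''.
case/or4P=> [h|h|h|/orP[h|h]]; exfalso.
- exact: split_adj_concurrent h h2 h3 a01 a12 a02.
- exact: split_adj_concurrent h1' h h3' a01 a12 a02.
- exact: split_adj_concurrent h2 h3 h a12 a23 a13.
- exact: split_adj_concurrent h1' h3' h a02 a23 a03.
- exact: split_adj_concurrent h1 h2' h a01 a13 a03.
Qed.

Variable q : nat.
Hypotheses (q0 : 0 < q) (cP : #|P| <= q ^ 3).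

(** The term of [p] counts the ordered pairs of differently coloured lines of [X] through [p]; by
    [meet_uniq] no adjacent pair is counted at two points. *)
Lemma sum_degrees (X : {set L}) :
  \sum_p 2 * (colour_count (chi p) (pencil inc X p) true *
              colour_count (chi p) (pencil inc X p) false)
  <= \sum_(v in X) #|X :&: [set u | split_adj v u]|.
Proof.
have E p : 2 * (colour_count (chi p) (pencil inc X p) true *
              colour_count (chi p) (pencil inc X p) false) =
  \sum_(v in X) \sum_(u in X) [&& inc p v, inc p u & chi p v != chi p u].
  transitivity (\sum_(v in X) \sum_(u in X)
    (([&& v \in X, inc p v & chi p v == true] && [&& u \in X, inc p u & chi p u == false])
    + ([&& v \in X, inc p v & chi p v == false] && [&& u \in X, inc p u & chi p u == true]))).
    have S c : colour_count (chi p) (pencil inc X p) c =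
       \sum_(v in X) [&& v \in X, inc p v & chi p v == c].
      rewrite /colour_count -sum1_card big_mkcond [RHS]big_mkcond /=.
      by apply: eq_bigr => v _; rewrite !inE; case: (v \in X); case: (inc p v);
        case: (chi p v == c).
    under [RHS]eq_bigr => v _ do rewrite big_split /=.
    rewrite big_split /= mul2n -addnn; congr (_ + _); last rewrite mulnC.
      rewrite !S big_distrlr /=; apply: eq_bigr => v _; apply: eq_bigr => u _.
      by rewrite mulnb.
    rewrite !S big_distrlr /=; apply: eq_bigr => v _; apply: eq_bigr => u _.
    by rewrite mulnb.
  apply: eq_bigr => v vX; apply: eq_bigr => u uX; rewrite vX uX.
  by case: (inc p v) (inc p u) (chi p v) (chi p u) => [] [] [] [].
under eq_bigr => p _ do rewrite E.
rewrite exchange_big; apply: leq_sum => v vX.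
rewrite exchange_big -sum1_card [X in _ <= X]big_mkcond [X in X <= _]big_mkcond /=.
apply: leq_sum => u _; rewrite !inE; case: (u \in X) => //=.
have [/[dup] /split_adj_neq vu /existsP[p /and3P[pv pu puv]]|nadj] := boolP (split_adj v u).
  rewrite (bigD1 p) //= pv pu puv big1 // => p' p'p.
  apply/eqP; rewrite eqb0; apply: contra p'p => /and3P[p'v p'u _].
  by rewrite (meet_uniq vu p'v p'u pv pu).
rewrite big1 // => p _; apply/eqP; rewrite eqb0; apply: contra nadj => H.
by apply/existsP; exists p.
Qed.

(** With [m = #|X|], Cauchy's inequality over at most [q ^ 3] points makes the squared sizes of the
    balanced pencils sum to at least [m ^ 2 / (4 q)]. A balanced pencil of size [d] yields at least
    [d ^ 2 / 8] ordered adjacent pairs, so the average degree inside [X] is at least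
    [m / (32 q)]. *)
Lemma split_adj_degree (X : {set L}) : 0 < #|X| ->
  q * #|X| <= 2 * balanced_incidences inc chi X ->
  exists2 v, v \in X & #|X| <= 32 * q * #|X :&: [set u | split_adj v u]|.
Proof.
move=> X0 good.
apply/exists_inP; apply: contraT; rewrite negb_exists_in => /forall_inP H.
set m := #|X| in X0 good *.
pose d p := #|pencil inc X p|.
pose bal p := ~~ unbalanced (chi p) (pencil inc X p).
have sd : m ^ 2 <= 4 * q * \sum_(p | bal p) d p ^ 2.
  (* AM-GM: [d ^ 2 >= 2 x d - x ^ 2] with [x = m / (2 q ^ 2)] *)
  have H1 : \sum_(p | bal p) 4 * q ^ 2 * m * d p <=
            \sum_(p | bal p) (4 * q ^ 4 * d p ^ 2 + m ^ 2).
    apply: leq_sum => p _; apply: leq_trans (_ : 2 * (2 * q ^ 2 * d p * m) <= _).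
      by rewrite leq_eqVlt; apply/orP; left; apply/eqP; lia.
    by apply: leq_trans (nat_Cauchy _ _) _; rewrite (expnM q 2 2 : q ^ 4 = _) !expnMn.
  have H2 : \sum_(p | bal p) m ^ 2 <= q ^ 3 * m ^ 2.
    rewrite sum_nat_const leq_mul2r (leq_trans _ cP) ?orbT //; exact: max_card.
  rewrite -big_distrr big_split -big_distrr /= in H1.
  move: good; rewrite /balanced_incidences -/bal -/d => good.
  have good' := leq_mul (leqnn (2 * q ^ 2 * m)) good.
  have q3 : 0 < q ^ 3 by rewrite expn_gt0 q0.
  rewrite -(leq_pmul2l q3); move: H1 H2 good'; rewrite /d /bal.
  move: (\sum_(p | _) _) (\sum_(p | _) _) (\sum_(p | _) _) => u v w.
  nia.
have big : m ^ 2 <= 32 * q * \sum_(v in X) #|X :&: [set u | split_adj v u]|.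
  apply: leq_trans sd _.
  have -> : 32 * q = 4 * q * 8 by lia.
  rewrite -[X in _ <= X]mulnA leq_mul2l; apply/orP; right.
  apply: leq_trans (leq_mul (leqnn 8) (sum_degrees X)).
  rewrite [X in _ <= _ * X](bigID bal) /= mulnDr big_distrr /=.
  apply: leq_trans (leq_addr _ _); apply: leq_sum => p /balanced_sqr.
  by rewrite /d; lia.
have : 32 * q * \sum_(v in X) #|X :&: [set u | split_adj v u]| < m * m.
  have [v vX] : exists v, v \in X by apply/card_gt0P.
  rewrite big_distrr /= [X in _ < X](_ : _ = \sum_(u in X) m).
    rewrite (bigD1 v) // [X in _ < X](bigD1 v) //= -addSn leq_add //.
      by rewrite ltnNge H.
    by apply: leq_sum => u /andP[uX _]; rewrite ltnW // ltnNge H.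
  by rewrite sum_nat_const.
by rewrite ltnNge -mulnn in big *; rewrite big.
Qed.

End SplitGraph.

(** * The Hermitian unital *)

Local Open Scope ring_scope.

Lemma card_roots_leq (F : finFieldType) (p : {poly F}) n :
  size p = n.+1 -> (#|[set x | root p x]| <= n)%N.
Proof.
move=> sp; rewrite -ltnS -sp cardE; apply: max_poly_roots (enum_uniq _).
  by rewrite -size_poly_gt0 sp.
by apply/allP => x; rewrite mem_enum inE.
Qed.

Section ThreePoints.
Variables (F : fieldType) (a b c : F).

(** Used with [a] the slope of a secant, [b] its conjugate and [z1], [z2], [z3] the conjugates of
    [x1], [x2], [x3]. The difference of the two sides combines the three products equal to [c], with
    coefficients of sum 0. *)
Lemma secant_three_points x1 x2 x3 z1 z2 z3 :
  (x1 - b) * (z1 - a) = c -> (x2 - b) * (z2 - a) = c ->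
  (x3 - b) * (z3 - a) = c ->
  (x2 - x3) * (z3 - z1) * (a - z2) = (x3 - x1) * (z2 - z3) * (a - z1).
Proof.
move=> h1 h2 h3; apply/eqP; rewrite -subr_eq0; apply/eqP.
transitivity ((x3 - b) * (z3 - a) * (z2 - z1) - (x2 - b) * (z2 - a) * (z3 - z1)
  - (x1 - b) * (z1 - a) * (z2 - z3)); first by ring.
by rewrite h1 h2 h3; ring.
Qed.
End ThreePoints.

Section Unital.
Variables (K : finFieldType) (q : nat).
Hypotheses (q1 : (1 < q)%N) (cK : #|K| = (q ^ 2)%N).
Hypothesis frobD : forall x y : K, (x + y) ^+ q = x ^+ q + y ^+ q.

Lemma frobK (x : K) : x ^+ q ^+ q = x.
Proof. by rewrite -exprM mulnn -cK expf_card. Qed.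

Lemma frobN (x : K) : (- x) ^+ q = - x ^+ q.
Proof.
apply/eqP; rewrite -addr_eq0 -frobD addNr expr0n; case: (q) q1 => //.
Qed.

Lemma frobB (x y : K) : (x - y) ^+ q = x ^+ q - y ^+ q.
Proof. by rewrite frobD frobN. Qed.

Lemma card_trace_fiber (c : K) : (#|[set y : K | (y ^+ q + y == c)%R]| <= q)%N.
Proof.
have sz : size ('X^q + ('X - c%:P)) = q.+1.
  by rewrite size_polyDl ?size_polyXn // size_XsubC.
apply: leq_trans (card_roots_leq sz); apply/subset_leq_card/subsetP => y.
by rewrite !inE rootE !hornerE subr_eq0.
Qed.

(** Degrees bound every norm fibre by [q.+1], and the [q ^ 2 - 1] nonzero elements are spread over
    at most [q - 1] fibres, so all of these are full. *)
Lemma card_norm_fiber (c : K) : c != 0 -> c ^+ q = c ->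
  #|[set u : K | u ^+ q.+1 == c]| = q.+1.
Proof.
pose N (d : K) := #|[set u : K | u ^+ q.+1 == d]|.
have N_le d : (N d <= q.+1)%N.
  have sz : size ('X^(q.+1) - d%:P) = q.+2 by rewrite size_XnsubC.
  apply: leq_trans (card_roots_leq sz); apply/subset_leq_card/subsetP => y.
  by rewrite !inE rootE !hornerE subr_eq0.
pose S := [set d : K | (d != 0) && (d ^+ q == d)].
have S_le : (#|S| <= q.-1)%N.
  have sz : size ('X^(q.-1) - (1 : K)%:P) = q.-1.+1.
    by rewrite size_XnsubC //; case: (q) q1 => [|[]].
  apply: leq_trans (card_roots_leq sz); apply/subset_leq_card/subsetP => y.
  rewrite !inE rootE !hornerE subr_eq0 => /andP[y0 /eqP yq]; apply/eqP.
  by apply: (mulfI y0); rewrite -exprS (ltn_predK q1) yq mulr1.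
have sumN : (\sum_(d in S) N d = (q ^ 2).-1)%N.
  transitivity #|[set~ (0 : K)]|; last by rewrite cardsC1 cK.
  rewrite -[RHS]sum1_card [RHS](partition_big (fun u : K => u ^+ q.+1) (mem S)) /=.
    apply: eq_bigr => d; rewrite inE => /andP[d0 _]; rewrite /N -sum1_card.
    apply: eq_bigl => u; rewrite !inE; apply/idP/andP => [ud|[]//]; split=> //.
    by apply: contraNneq d0 => u0; rewrite -(eqP ud) u0 expr0n.
  move=> u; rewrite !inE => u0; rewrite expf_neq0 //=.
  by rewrite exprS exprMn frobK mulrC.
move=> c0 cq; apply/eqP; rewrite eqn_leq N_le leqNgt; apply/negP => lt.
have cS : c \in S by rewrite inE c0 cq eqxx.
(* A deficient fibre over [c] would leave a total of at most [q ^ 2 - 2]. *)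
have : (\sum_(d in S) N d <= q + q.-2 * q.+1)%N.
  rewrite (bigD1 c) //= leq_add //.
  apply: (@leq_trans (\sum_(d in S | d != c) q.+1)%N); first exact: leq_sum.
  rewrite sum_nat_const leq_mul2r; apply/orP; right.
  apply: (@leq_trans #|[predD1 S & c]|).
    apply/subset_leq_card/subsetP => d; rewrite unfold_in => /andP[dS dc].
    by rewrite inE dc.
  by move: S_le; rewrite (cardD1 c) cS; lia.
by rewrite sumN; case: (q) q1 => [|[|k]] // _; rewrite -mulnn; lia.
Qed.

(** Affine part of the Hermitian curve; the pair [(a, b)] encodes the non-vertical line
    [y = a x + b]. By [on_curve_line] this line meets the curve where [x - a ^+ q] has norm
    [b ^+ q + b + a ^+ q.+1]; if that value is 0 there is a single common point, and [is_secant]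
    excludes such tangents. *)
Definition on_curve (z : K * K) := z.2 ^+ q + z.2 == z.1 ^+ q.+1.
Definition is_secant (l : K * K) := l.2 ^+ q + l.2 + l.1 ^+ q.+1 != 0.
Definition on_line (l z : K * K) := z.2 == l.1 * z.1 + l.2.

Definition unital_point := {z : K * K | on_curve z}.
Definition unital_line := {l : K * K | is_secant l}.
Definition unital_inc (p : unital_point) (l : unital_line) := on_line (val l) (val p).

Lemma card_pair_leq (Q : K -> K -> bool) :
  (forall x, #|[set y | Q x y]| <= q)%N ->
  (#|[set z : K * K | Q z.1 z.2]| <= q ^ 3)%N.
Proof.
move=> H; rewrite -sum1_card; under eq_bigl => z do rewrite inE.
rewrite -(pair_big_dep predT Q (fun _ _ => 1%N)) /=.
apply: (@leq_trans (\sum_(x : K) q)%N).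
  apply: leq_sum => x _; apply: leq_trans (H x).
  by rewrite -sum1_card; under [X in (_ <= X)%N]eq_bigl => z do rewrite inE.
by rewrite sum_nat_const cK -expnSr.
Qed.

Lemma card_unital_point : (#|{: unital_point}| <= q ^ 3)%N.
Proof.
rewrite card_sig; have := @card_pair_leq (fun x y => on_curve (x, y)).
rewrite cardsE => H; apply: leq_trans (H _).
  by apply: subset_leq_card; apply/subsetP => -[x y].
by move=> x; exact: (card_trace_fiber (x ^+ q.+1)).
Qed.

Lemma card_unital_line : (q ^ 4 <= #|{: unital_line}| + q ^ 3)%N.
Proof.
have := @card_pair_leq (fun a b => ~~ is_secant (a, b)).
rewrite card_sig cardsE => H.
have <- : #|{: K * K}| = (q ^ 4)%N by rewrite card_prod cK -expnD.
rewrite -(cardC is_secant) leq_add2l; apply: leq_trans (H _).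
  by apply: subset_leq_card; apply/subsetP => -[x y].
move=> a; apply: leq_trans (card_trace_fiber (- a ^+ q.+1)).
apply: subset_leq_card; apply/subsetP => b; rewrite !inE negbK.
by rewrite addr_eq0.
Qed.

(** The line [(0, 0)] is a tangent. Strictness later allows [#|L|.+1] to be bounded by [q ^ 4]. *)
Lemma card_unital_line_lt : (#|{: unital_line}| < q ^ 4)%N.
Proof.
have <- : #|{: K * K}| = (q ^ 4)%N by rewrite card_prod cK -expnD.
rewrite card_sig; apply: proper_card; apply/properP; split; first exact/subsetP.
exists (0, 0) => //; rewrite unfold_in /is_secant /= exprS mul0r expr0n.
by case: (q) q1 => //= n _; rewrite !addr0 eqxx.
Qed.

Lemma on_curve_line (l z : K * K) : on_line l z ->
  on_curve z = ((z.1 - l.1 ^+ q) ^+ q.+1 == l.2 ^+ q + l.2 + l.1 ^+ q.+1).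
Proof.
case: l z => [a b] [x y]; rewrite /on_line /on_curve /= => /eqP->.
rewrite [x ^+ q.+1]exprS [(x - _) ^+ q.+1]exprS [a ^+ q.+1]exprS.
rewrite [(a * x + b) ^+ q]frobD [(a * x) ^+ q]exprMn [(x - _) ^+ q]frobB frobK.
move: (x ^+ q) (a ^+ q) (b ^+ q) => X A B.
rewrite -subr_eq0 -[RHS]subr_eq0 -[RHS]oppr_eq0; congr (_ == 0); ring.
Qed.

(** The value [c] is fixed by the Frobenius map and nonzero, so it has [q.+1] preimages under the
    norm; shifted by [a ^+ q] they are abscissae of points of the line. *)
Lemma unital_line_size (l : unital_line) :
  (q <= #|[set p | unital_inc p l]|)%N.
Proof.
case: l => [[a b] /= sec]; set l := (a, b); set c := b ^+ q + b + a ^+ q.+1.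
have cq : c ^+ q = c.
  rewrite /c !frobD -!exprM mulnC !exprM frobK [a ^+ q ^+ _]exprS frobK exprS.
  by rewrite [b + _]addrC [_ * a]mulrC.
have := card_norm_fiber sec cq; set U := [set _ | _] => cU.
pose f u : K * K := (u + a ^+ q, a * (u + a ^+ q) + b).
have finj : injective f by move=> u v [/addIr].
apply: (@leq_trans #|f @: U|); first by rewrite card_imset // cU.
rewrite -(card_imset _ (@val_inj _ _ unital_point)).
apply/subset_leq_card/subsetP => _ /imsetP[u uU ->].
have fl : on_line l (f u) by rewrite /on_line.
have fc : on_curve (f u).
  by rewrite (on_curve_line fl) /= addrK; move: uU; rewrite inE.
by apply/imsetP; exists (Sub (f u) fc); rewrite ?inE.
Qed.

Lemma unital_meet_uniq (l m : unital_line) (p p' : unital_point) : l != m ->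
  unital_inc p l -> unital_inc p m -> unital_inc p' l -> unital_inc p' m ->
  p = p'.
Proof.
case: l m p p' => [[a b] sl] [[a' b'] sm] [[x y] cx] [[x' y'] cx'].
rewrite /unital_inc /on_line /= -(inj_eq val_inj) /= => lm /eqP h1 /eqP h2 /eqP h3 /eqP h4.
apply/val_inj => /=.
have E : (a - a') * (x - x') = 0.
  transitivity ((a * x + b - (a' * x + b')) - (a * x' + b - (a' * x' + b'))); first by ring.
  by rewrite -h1 -h2 -h3 -h4; ring.
have [xx|xx] := eqVneq x x'; first by rewrite h1 h3 xx.
move/eqP: E; rewrite mulf_eq0 !subr_eq0 (negbTE xx) orbF => /eqP aa.
case/eqP: lm; rewrite aa; congr pair.
by apply: (addrI (a' * x)); rewrite -h2 h1 aa.
Qed.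

(* Let A, B, C be the vertices of the triangle formed by the first three lines.
   Isotropy of the points D, E, F of the fourth line, multiplied together using
   Menelaus, yields [ceva], which says that the Gram determinant of A, B, C for
   the Hermitian form y + bar y' - x bar x' vanishes. *)
Lemma unital_onan_free : onan_free unital_inc.
Proof.
move=> [[a1 b1] s1] [[a2 b2] s2] [[a3 b3] s3] [[a4 b4] s4].
move=> [[xA yA] cA] [[xB yB] cB] [[xC yC] cC] [[xD yD] cD] [[xE yE] cE] [[xF yF] cF].
rewrite /unital_inc /on_line /=.
move=> /eqP A2 /eqP A3 /eqP B1 /eqP B3 /eqP C1 /eqP C2 /eqP D1 /eqP D4
  /eqP E2 /eqP E4 /eqP F3 /eqP F4.
apply: contraT; rewrite !negb_or => /and5P[/eqP A1 /eqP B2 /eqP A4 /eqP B4 /eqP C4].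
have AB : xA - xB != 0.
  by rewrite subr_eq0; apply/eqP => E; apply: A1; rewrite A3 E -B3.
have CA : xC - xA != 0.
  by rewrite subr_eq0; apply/eqP => E; apply: A1; rewrite A2 -E -C2.
have a23 : a2 - a3 != 0.
  rewrite subr_eq0; apply/eqP => E; apply: B2; rewrite B3 E; congr (_ + _).
  by apply: (addrI (a2 * xA)); rewrite -A2 E -A3.
have rD : xD - xB != 0.
  by rewrite subr_eq0; apply/eqP => E; apply: B4; rewrite B1 -E -D1.
have rE : xE - xC != 0.
  by rewrite subr_eq0; apply/eqP => E; apply: C4; rewrite C2 -E -E2.
have rF : xF - xA != 0.
  by rewrite subr_eq0; apply/eqP => E; apply: A4; rewrite A3 -E -F3.
pose bar (x : K) := x ^+ q.
have secant (a b x y x' y' x'' y'' : K) :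
    on_curve (x, y) -> on_curve (x', y') -> on_curve (x'', y'') ->
    y = a * x + b -> y' = a * x' + b -> y'' = a * x'' + b ->
    (x' - x'') * (bar x'' - bar x) * (a - bar x') =
    (x'' - x) * (bar x' - bar x'') * (a - bar x).
  move=> h h' h'' l l' l''.
  have on (u v : K) : on_curve (u, v) -> v = a * u + b ->
      (u - bar a) * (bar u - a) = b ^+ q + b + a ^+ q.+1.
    move=> c e; have := @on_curve_line (a, b) (u, v).
    rewrite /on_line /= e eqxx => /(_ isT); rewrite -e c => /esym/eqP <-.
    by rewrite exprS frobB frobK.
  exact: secant_three_points (on _ _ h l) (on _ _ h' l') (on _ _ h'' l'').
have T1 := secant _ _ _ _ _ _ _ _ cB cC cD B1 C1 D1.
have T2 := secant _ _ _ _ _ _ _ _ cC cA cE C2 A2 E2.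
have T3 := secant _ _ _ _ _ _ _ _ cA cB cF A3 B3 F3.
(* Equation of the fourth line. Its values at two vertices of the triangle give the ratio in which
   the fourth line cuts that side; multiplying over the three sides yields Menelaus. *)
pose g x y := y - a4 * x - b4.
have g0 x y : y <> a4 * x + b4 -> g x y != 0.
  by move=> h; apply/eqP => gz; apply: h; apply/eqP; rewrite -subr_eq0 opprD addrA; apply/eqP.
have gg a b x y x' y' x'' y'' : y = a * x + b -> y' = a * x' + b ->
   y'' = a * x'' + b -> y'' = a4 * x'' + b4 ->
   g x y * (x' - x'') = - (g x' y' * (x'' - x)).
  move=> l l' l'' l4; have e : b4 = a * x'' + b - a4 * x'' by rewrite -l'' l4; ring.
  by rewrite /g l l' e; ring.
have G1 := gg _ _ _ _ _ _ _ _ B1 C1 D1 D4.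
have G2 := gg _ _ _ _ _ _ _ _ C2 A2 E2 E4.
have G3 := gg _ _ _ _ _ _ _ _ A3 B3 F3 F4.
have menelaus : (xC - xD) * (xA - xE) * (xB - xF) =
   - ((xD - xB) * (xE - xC) * (xF - xA)).
  have n0 : g xA yA * g xB yB * g xC yC != 0 by rewrite !mulf_neq0 ?g0.
  apply: (mulfI n0).
  transitivity (g xB yB * (xC - xD) * (g xC yC * (xA - xE)) * (g xA yA * (xB - xF))).
    by ring.
  by rewrite G1 G2 G3; ring.
have menelausb : (bar xC - bar xD) * (bar xA - bar xE) * (bar xB - bar xF) =
   - ((bar xD - bar xB) * (bar xE - bar xC) * (bar xF - bar xA)).
  have := congr1 bar menelaus; rewrite /bar frobN !exprMn !frobB //.
have ceva : (a1 - bar xC) * (a2 - bar xA) * (a3 - bar xB) =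
  (a1 - bar xB) * (a2 - bar xC) * (a3 - bar xA).
  have S0 : (xD - xB) * (xE - xC) * (xF - xA) != 0 by rewrite !mulf_neq0.
  have Sb0 : (bar xD - bar xB) * (bar xE - bar xC) * (bar xF - bar xA) != 0.
    by rewrite /bar -!frobB -!exprMn expf_neq0.
  apply: (mulfI S0); apply: (mulfI Sb0); apply: oppr_inj.
  (* This is the product of the left sides of [T1], [T2], [T3]; the factors involving D, E, F are
     removed by Menelaus and its conjugate. *)
  transitivity (((xC - xD) * (bar xD - bar xB) * (a1 - bar xC)) *
     ((xA - xE) * (bar xE - bar xC) * (a2 - bar xA)) *
     ((xB - xF) * (bar xF - bar xA) * (a3 - bar xB))).
    transitivity ((bar xD - bar xB) * (bar xE - bar xC) * (bar xF - bar xA) *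
      ((xC - xD) * (xA - xE) * (xB - xF) *
      ((a1 - bar xC) * (a2 - bar xA) * (a3 - bar xB)))); last by ring.
    by rewrite menelaus; ring.
  rewrite T1 T2 T3.
  transitivity ((bar xC - bar xD) * (bar xA - bar xE) * (bar xB - bar xF) *
      ((xD - xB) * (xE - xC) * (xF - xA) *
      ((a1 - bar xB) * (a2 - bar xC) * (a3 - bar xA)))); first by ring.
  by rewrite menelausb; ring.
(* Determinant of the vectors AB and AC, nonzero since the triangle is not degenerate; [gram] and
   [ceva] together would make its norm vanish. *)
pose det := (xB - xA) * (xC - xA) * (a2 - a3).
have det0 : det != 0 by rewrite !mulf_neq0 // -oppr_eq0 opprB.
have barE x y : on_curve (x, y) -> bar y = x * bar x - y.
  by move=> /eqP /= h; rewrite -exprS -h /bar addrK.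
have detE : det = (xB - xA) * (yC - yA) - (xC - xA) * (yB - yA).
  have -> : yC - yA = a2 * (xC - xA) by rewrite C2 A2; ring.
  have -> : yB - yA = a3 * (xB - xA) by rewrite B3 A3; ring.
  by rewrite /det; ring.
have detb : bar det = (bar xB - bar xA) * ((xC * bar xC - yC) - (xA * bar xA - yA))
   - (bar xC - bar xA) * ((xB * bar xB - yB) - (xA * bar xA - yA)).
  by rewrite detE -!barE // /bar frobB !exprMn !frobB.
have e1 : a1 * (xB - xC) = yB - yC by rewrite B1 C1; ring.
have e2 : a2 * (xC - xA) = yC - yA by rewrite A2 C2; ring.
have e3 : a3 * (xA - xB) = yA - yB by rewrite A3 B3; ring.
have gram : (xB - xC) * (xC - xA) * (xA - xB) *
   ((a1 - bar xC) * (a2 - bar xA) * (a3 - bar xB) -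
   (a1 - bar xB) * (a2 - bar xC) * (a3 - bar xA)) = det * bar det.
  transitivity ((a1 * (xB - xC) - bar xC * (xB - xC)) *
     (a2 * (xC - xA) - bar xA * (xC - xA)) *
     (a3 * (xA - xB) - bar xB * (xA - xB)) -
     (a1 * (xB - xC) - bar xB * (xB - xC)) *
     (a2 * (xC - xA) - bar xC * (xC - xA)) *
     (a3 * (xA - xB) - bar xA * (xA - xB))); first by ring.
  rewrite e1 e2 e3 detb detE.
  move: (bar xA) (bar xB) (bar xC) => XA XB XC.
  ring.
have : det * bar det != 0 by rewrite mulf_neq0 // expf_neq0.
by rewrite -gram ceva subrr mulr0 eqxx.
Qed.

End Unital.

Local Close Scope ring_scope.

(** * The graph of secants and the resulting count of t-cliques *)

Lemma leq_mul4_exp2 k : 10 <= k -> 4 * k + 2 <= 2 ^ (k - 4).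
Proof.
elim: k => [//|k IH]; rewrite leq_eqVlt => /predU1P[<- //|]; rewrite ltnS => k10.
by have := IH k10; rewrite subSn ?(leq_trans _ k10) // expnS; lia.
Qed.

Lemma mattheus_verstraete_graph k : 10 <= k ->
  exists (L : finType) (e : rel L),
  [/\ symmetric e, irreflexive e, clique4_free e,
      (2 ^ k) ^ 4 <= 2 * #|L| /\ #|L| < (2 ^ k) ^ 4 &
      forall Y : {set L}, 32 * (2 ^ k) ^ 2 <= #|Y| ->
        exists2 v, v \in Y & #|Y| <= 32 * 2 ^ k * #|Y :&: [set u | e v u]|].
Proof.
move=> k10; set q := 2 ^ k.
have q1 : 1 < q by rewrite -[1](expn0 2) ltn_exp2l //; lia.
have [K charK cK] : {K : finFieldType | 2 \in [pchar K]%R & #|K| = 2 ^ (2 * k)}.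
  by apply: PrimePowerField => //; lia.
have {}cK : #|K| = q ^ 2 by rewrite cK mulnC expnM.
have frobD (x y : K) : ((x + y) ^+ q = x ^+ q + y ^+ q)%R.
  by apply: exprDn_pchar; rewrite pnatX (pnatE _ (isT : prime 2)) charK.
pose r := 2 ^ (k - 4).
have qr : q = 16 * r by rewrite /q /r -(expnD 2 4) subnKC // (leq_trans _ k10).
have r0 : 0 < r by rewrite expn_gt0.
have cL := card_unital_line_lt q1 cK.
have cL' := card_unital_line q1 cK.
have cL4 : 4 * #|{: unital_line K q}| <= 2 ^ r.
  (* Here [10 <= k] matters: [4 * q ^ 4 = 2 ^ (4 k + 2)], and [4 k + 2 <= 2 ^ (k - 4)] fails at
     [k = 9]. *)
  apply: leq_trans (leq_mul (leqnn 4) (ltnW cL)) _.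
  rewrite /q -expnM -(expnD 2 2) leq_exp2l //; have := leq_mul4_exp2 k10; rewrite -/r; lia.
have [chi good] := @good_colouring rat _ _ (@unital_inc K q) q r qr r0
  (card_unital_point q1 cK) cL4 (unital_line_size q1 cK frobD).
have cL2 : q ^ 4 <= 2 * #|{: unital_line K q}|.
  have : 2 * q ^ 3 <= q ^ 4 by rewrite (expnS q 3) leq_mul2r q1 orbT.
  by move: cL'; move: #|_| (q ^ 3) (q ^ 4) => u v w; lia.
pose meet := @unital_meet_uniq K q.
exists (unital_line K q), (split_adj (@unital_inc K q) chi); split.
- exact: split_adj_sym.
- exact: split_adj_irr.
- apply: split_adj_clique4_free => //; exact: unital_onan_free.
- by [].
- move=> Y mY.
  have Y0 : 0 < #|Y|.
    by apply: leq_trans mY; rewrite muln_gt0 expn_gt0 (ltnW q1).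
  exact: (split_adj_degree (@meet) (ltnW q1) (card_unital_point q1 cK) Y0 (good Y mY)).
Qed.

(** Bernoulli's inequality; with [D = d.+1] it reads [(1 - 1/D) ^ D <= 1/2]. *)
Lemma expn_double d : 0 < d -> 2 * d ^ d.+1 <= d.+1 ^ d.+1.
Proof.
move=> d0; have bernoulli n : (d + n) * d ^ n <= d * d.+1 ^ n.
  elim: n => [|n IH]; first by rewrite addn0.
  have := leq_mul (leqnn d.+1) IH; rewrite !expnS.
  by move: (d ^ n) (d.+1 ^ n) => u v; nia.
rewrite -(leq_pmul2l d0); apply: leq_trans (bernoulli d.+1).
by rewrite mulnA leq_mul2r; apply/orP; right; lia.
Qed.

Lemma bin_leq_exp2 n m : 'C(n, m) <= 2 ^ n.
Proof.
elim: n m => [|n IH] [|m]; rewrite ?bin0 ?expn_gt0 //.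
by rewrite binS expnS mul2n -addnn leq_add.
Qed.

(** Both sides are compared with [(2 * t) ^_ t = 'C(2 * t, t) * t!]. *)
Lemma expn_leq_fact t : t ^ t <= 4 ^ t * t`!.
Proof.
apply: (@leq_trans ((2 * t) ^_ t)).
  rewrite ffact_prod -{2}[t]card_ord -prod_nat_const; apply: leq_prod => i _.
  by have := ltn_ord i; lia.
by rewrite -bin_ffact leq_mul2r -(expnM 2 2 t) bin_leq_exp2 orbT.
Qed.

Lemma ramsey_card_cliques_pow k t N (G : sgraph) :
  10 <= k -> 512 * k ^ 2 * 2 ^ k <= t -> 512 * N <= t * (2 ^ k) ^ 2 ->
  is_ramsey 4 t G -> N ^ t <= t`! * #|cliques (@adj G) setT t|.
Proof.
move=> k10 kt Nt rG; set Q := #|_|.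
have [L [e [e_sym e_irr e4 [cL1 cL2] dens]]] := mattheus_verstraete_graph k10.
set q := 2 ^ k in kt Nt cL1 cL2 dens.
have q0 : 0 < q by rewrite expn_gt0.
(* [D] comes from the degree condition. Every [D] steps halve the container, and [2 * k] halvings
   divide [q ^ 4] by [q ^ 2]. *)
pose D := 32 * q; pose h := D * (2 * k).
have D1 : 1 < D by rewrite /D; lia.
have hM : #|L| * D.-1 ^ h <= 32 * q ^ 2 * D ^ h.
  have dbl : 2 * D.-1 ^ D <= D ^ D.
    by have := @expn_double D.-1; rewrite (ltn_predK D1); apply; lia.
  have pow : q ^ 2 * D.-1 ^ h <= D ^ h.
    have -> : q ^ 2 = 2 ^ (2 * k) by rewrite mulnC expnM.
    by rewrite /h 2![_ ^ (D * _)]expnM -expnMn leq_exp2r //; lia.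
  apply: leq_trans (leq_mul (ltnW cL2) (leqnn _)) _.
  rewrite (expnD q 2 2) -mulnA; apply: leq_mul => //; lia.
have t0 : 0 < t by apply: leq_trans kt; rewrite !muln_gt0 q0; lia.
have L0 : 0 < #|L| by case: #|L| cL1 => //; rewrite muln0 leqn0 expn_eq0; lia.
have := ramsey_card_cliques e_sym e_irr e4 rG L0 (fun Y h => dens Y (ltnW h)) hM.
rewrite -/Q => H.
have pow2 : #|L|.+1 ^ h <= 2 ^ t.
  apply: (@leq_trans ((q ^ 4) ^ h)); first by rewrite leq_exp2r // /h /D; lia.
  rewrite /q -!expnM leq_exp2l // /h /D; apply: leq_trans kt; lia.
(* Here [128 = 2 * 2 * 32]: a factor 2 from [q ^ 4 <= 2 * #|L|], another from [pow2], and 32 from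
   the container size. The final 512 has one more factor 4, from [expn_leq_fact]. *)
have Q128 : (q ^ 2) ^ t <= Q * 128 ^ t.
  have q20 : 0 < q ^ 2 by rewrite muln_gt0 q0.
  have q2t : 0 < (q ^ 2) ^ t by rewrite expn_gt0 q20.
  rewrite -(leq_pmul2l q2t) -expnMn -expnD.
  apply: (@leq_trans ((2 * #|L|) ^ t)); first by rewrite leq_exp2r.
  rewrite expnMn; apply: leq_trans (leq_mul (leqnn _) H) _.
  apply: (@leq_trans (2 ^ t * (Q * (2 ^ t * (32 * q ^ 2) ^ t)))).
    by rewrite !leq_mul.
  by rewrite (_ : 128 = 2 * (2 * 32)) // !expnMn; lia.
have t512 : 0 < 512 ^ t by rewrite expn_gt0.
rewrite -(leq_pmul2l t512) -expnMn.
apply: leq_trans (_ : (t * q ^ 2) ^ t <= _).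
  by rewrite leq_exp2r.
rewrite expnMn (_ : 512 = 4 * 128) // expnMn mulnACA.
by rewrite leq_mul ?expn_leq_fact // mulnC.
Qed.

(** * Ramsey numbers *)

(** The clique sizes are shifted by one, so that the recursion over the two colour neighbourhoods of
    a vertex is Pascal's rule. *)
Lemma erdos_szekeres a b (T : finType) (c : {set T} -> bool) (A : {set T}) :
  'C(a + b, a) <= #|A| ->
  (exists2 B : {set T}, #|B| = a.+1 /\ B \subset A & mono c true B) \/
  (exists2 B : {set T}, #|B| = b.+1 /\ B \subset A & mono c false B).
Proof.
have single d (S : {set T}) : 0 < #|S| ->
    exists2 B : {set T}, #|B| = 1 /\ B \subset S & mono c d B.
  move=> /card_gt0P[v vS]; exists [set v]; first by rewrite cards1 sub1set.
  by move=> x y /set1P-> /set1P->; rewrite eqxx.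
elim: a b A => [|a IHa] b A; first by rewrite bin0 => /single; left.
elim: b A => [|b IHb] A leA.
  by right; apply: single; apply: leq_trans leA; rewrite addn0 binn.
have /card_gt0P[v vA] : 0 < #|A|.
  by apply: leq_trans leA; rewrite bin_gt0 leq_addr.
pose N d := [set x in A :\ v | c [set v; x] == d].
have sN d : N d \subset A by apply/subsetP=> x; rewrite !inE => /andP[/andP[]].
have ext d n (B : {set T}) : #|B| = n /\ B \subset N d -> mono c d B ->
    exists2 B : {set T}, #|B| = n.+1 /\ B \subset A & mono c d B.
  move=> [cB sB] mB.
  have colv x : x \in B -> c [set v; x] = d.
    by move=> /(subsetP sB); rewrite !inE => /andP[_ /eqP].
  have vB : v \notin B by apply/negP => /(subsetP sB); rewrite !inE eqxx.
  exists (v |: B); last first.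
    move=> x y /setU1P[->|xB] /setU1P[->|yB]; rewrite ?eqxx // => ne.
    - exact: colv.
    - by rewrite setUC; apply: colv.
    - exact: mB.
  by rewrite cardsU1 vB cB subUset sub1set vA (subset_trans sB).
have cN : #|A| = (#|N true| + #|N false|).+1.
  rewrite (cardsD1 v) vA -(cardsID [set x | c [set v; x]] (A :\ v)).
  congr (_ + _).+1; apply: eq_card => x; rewrite !inE ?eqb_id //.
  by rewrite eqbF_neg andbC.
have [le1|lt1] := leqP 'C(a + b.+1, a) #|N true|.
  have [[B hB mB]|[B [cB sB] mB]] := IHa b.+1 _ le1; [left|right].
    exact: ext hB mB.
  by exists B => //; split=> //; apply: subset_trans sB _.
(* The strict inequality [lt1] makes up for the vertex [v], which lies in neither neighbourhood. *)
have le2 : 'C(a.+1 + b, a.+1) <= #|N false|.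
  move: leA; rewrite cN addSn binS -addSnnS; move: lt1; rewrite -addSnnS.
  lia.
have [[B [cB sB] mB]|[B hB mB]] := IHb _ le2; [left|right].
  by exists B => //; split=> //; apply: subset_trans sB _.
exact: ext hB mB.
Qed.

Lemma ramsey4_leq t : 0 < t -> ramsey 4 t <= 27 * t ^ 3.
Proof.
case: t => // b _; apply: (@leq_trans 'C(3 + b, 3)); last first.
  apply: (@leq_trans ((3 + b) ^_ 3)); first by rewrite -bin_ffact leq_pmulr.
  apply: leq_trans (ffact_leq_expn _ _) _.
  by rewrite (_ : 27 = 3 ^ 3) // -expnMn leq_exp2r //; lia.
rewrite /ramsey; case: ex_minnP => n _; apply.
apply/forallP => c.
have [|[B [cB _] mB]|[B [cB _] mB]] := @erdos_szekeres 3 b _ c setT.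
- by rewrite cardsT card_ord.
- by rewrite (mono_copies cB mB).
- by rewrite (mono_copies cB mB) orbT.
Qed.

Lemma ramsey_is_ramsey t1 t2 : is_ramsey t1 t2 (complete_graph (ramsey t1 t2)).
Proof. by rewrite /ramsey; case: ex_minnP. Qed.

Lemma F_ramsey_leq (F G : sgraph) t1 t2 :
  is_ramsey t1 t2 G -> F_ramsey F t1 t2 <= #|copies F G|.
Proof.
move=> rG; rewrite /F_ramsey; case: ex_minnP => n _; apply.
by apply/asboolP; exists G.
Qed.

Lemma F_ramsey_attained (F : sgraph) t1 t2 :
  exists2 G, is_ramsey t1 t2 G & #|copies F G| = F_ramsey F t1 t2.
Proof.
rewrite /F_ramsey; case: ex_minnP => n /asboolP[G [rG cG]] _.
by exists G.
Qed.

Lemma card_copies_complete_graph s n :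
  #|copies (complete_graph s) (complete_graph n)| = 'C(n, s).
Proof.
rewrite card_copies_cliques -[n in RHS]card_ord -card_draws.
apply: eq_card => A; rewrite [RHS]inE; apply/cliquesP/eqP => [[]//|cA].
by split; rewrite ?subsetT.
Qed.

Lemma F_ramsey_complete_leq s t1 t2 :
  F_ramsey (complete_graph s) t1 t2 <= 'C(ramsey t1 t2, s).
Proof.
by rewrite -card_copies_complete_graph; apply/F_ramsey_leq/ramsey_is_ramsey.
Qed.

(** Colouring every edge blue shows that a Ramsey graph contains a t2-clique; [cliques_pow] with
    [N = 1] then passes to size [s]. *)
Lemma F_ramsey_complete_gt0 s t1 t2 : 1 < t1 -> 0 < s <= t2 ->
  0 < F_ramsey (complete_graph s) t1 t2.
Proof.
move=> t1_gt1 st; have [G rG <-] := F_ramsey_attained (complete_graph s) t1 t2.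
rewrite card_copies_cliques.
suff: 1 ^ s <= s`! * #|cliques (@adj G) setT s|.
  by rewrite exp1n muln_gt0 => /andP[].
apply: (cliques_pow (@adj_sym G) (@adj_irrefl G) st).
rewrite exp1n muln_gt0 fact_gt0 /=; apply/card_gt0P.
move/forallP: rG => /(_ [ffun=> false]) /orP[] /color_class_clique[A cA colA].
  case/cliquesP: cA => _ cA _.
  have /card_gt1P[x [y [xA yA xy]]] : 1 < #|A| by rewrite cA.
  by have := colA x y xA yA xy; rewrite ffunE.
by exists A.
Qed.

Lemma F_ramsey_lower k t N s :
  10 <= k -> 512 * k ^ 2 * 2 ^ k <= t -> 512 * N <= t * (2 ^ k) ^ 2 ->
  0 < s <= t ->
  'C(N, s) <= F_ramsey (complete_graph s) 4 t /\
  N ^ s <= s`! * F_ramsey (complete_graph s) 4 t.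
Proof.
move=> k10 kt Nt st; have [G rG <-] := F_ramsey_attained (complete_graph s) 4 t.
have := ramsey_card_cliques_pow k10 kt Nt rG; rewrite card_copies_cliques => H.
split; first exact: (bin_card_cliques (@adj_sym G) (@adj_irrefl G) st H).
exact: (cliques_pow (@adj_sym G) (@adj_irrefl G) st H).
Qed.

(** The largest admissible [k] is taken; passing to [k.+1] multiplies [k ^ 2 * 2 ^ k] by at most 8,
    and [4096 = 8 * 512]. *)
Lemma dyadic_scale t : 512 * 10 ^ 2 * 2 ^ 10 <= t ->
  exists k, [/\ 10 <= k, 512 * k ^ 2 * 2 ^ k <= t & t <= 4096 * k ^ 2 * 2 ^ k].
Proof.
move=> t0; pose Pk k := 512 * k ^ 2 * 2 ^ k <= t.
have bd k : Pk k -> k <= t.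
  rewrite /Pk => kt; case: (posnP k) => [->//|k0].
  have := ltn_expl k (isT : 1 < 2); move: kt; move: (2 ^ k) => q; nia.
have exP : exists k, Pk k by exists 10.
have [k kt kmax] := ex_maxnP exP bd.
have k10 : 10 <= k by apply: kmax.
exists k; split=> //; rewrite leqNgt; apply/negP => lt.
suff /kmax : Pk k.+1 by rewrite ltnn.
apply: leq_trans (ltnW lt); rewrite (expnS 2 k).
move: (2 ^ k) => q; have : k.+1 ^ 2 <= 4 * k ^ 2 by nia.
move: (k.+1 ^ 2) (k ^ 2) => u v uv; have := leq_mul uv (leqnn q); lia.
Qed.

(** * Asymptotics *)

From mathcomp Require Import all_classical all_reals all_analysis.
Import Order.TTheory GRing.Theory Num.Theory.
Import numFieldNormedType.Exports.
Local Open Scope classical_set_scope.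
Local Open Scope ring_scope.

Section Asymptotics.
Variable R : realType.
Implicit Types t s : nat.

Lemma ln2_ge_half : 2^-1 <= ln (2 : R).
Proof.
have := @le_ln1Dx R (- 2^-1); rewrite (_ : 1 + - 2^-1 = 2^-1); last by lra.
rewrite lnV ?posrE //; have -> : (-1 : R) < - 2^-1 by lra.
by move=> /(_ isT); lra.
Qed.

Lemma ln2_le1 : ln (2 : R) <= 1.
Proof. by have := @le_ln1Dx R 1; rewrite (_ : (-1 : R) < 1); [apply | lra]. Qed.

(* [2 ^ 37 = 2 ^ 9 * 2 ^ 24 * 2 ^ 4]: [ramsey_card_cliques_pow] allows
   N = t q ^ 2 / 2 ^ 9, and t <= 2 ^ 12 k ^ 2 q with q = 2 ^ k, k <= 2 ln t. *)
Definition mv_bound t : R := (2 ^+ 37)^-1 * t%:R ^+ 3 / ln (t%:R : R) ^+ 4.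

Lemma F_ramsey_lower_log : exists t0 : nat, forall t s, (t0 <= t)%N -> (0 < s <= t)%N ->
  ('C(Num.truncn (mv_bound t), s) <= F_ramsey (complete_graph s) 4 t)%N /\
  (Num.truncn (mv_bound t) ^ s <= s`! * F_ramsey (complete_graph s) 4 t)%N.
Proof.
exists (512 * 10 ^ 2 * 2 ^ 10)%N => t s /dyadic_scale[k [k10 kt tk]].
apply: (F_ramsey_lower k10 kt).
move Eq : (2 ^ k)%N kt tk => q kt tk; set L := ln (t%:R : R).
have q0 : (0 < q)%N by rewrite -Eq expn_gt0.
have t0 : (0 < t)%N by apply: leq_trans kt; rewrite !muln_gt0 q0; lia.
have tR : 0 < t%:R :> R by rewrite ltr0n.
have kL : k%:R <= 2 * L.
  have : ln (q%:R : R) <= L.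
    rewrite ler_ln ?posrE ?ltr0n // ler_nat; apply: leq_trans kt.
    by rewrite leq_pmull // !muln_gt0; lia.
  rewrite -Eq natrX lnXn // -[_ *+ k]mulr_natl => h.
  have h2 : k%:R * 2^-1 <= k%:R * ln (2 : R).
    by rewrite ler_wpM2l // ln2_ge_half.
  by lra.
have kR : 10 <= k%:R :> R by rewrite (ler_nat _ 10).
have L0 : 0 < L by lra.
have L4 : k%:R ^+ 4 <= 16 * L ^+ 4.
  have -> : 16 * L ^+ 4 = (2 * L) ^+ 4 by ring.
  by apply: lerXn2r => //; rewrite nnegrE; lra.
have x0 : 0 <= mv_bound t.
  by rewrite /mv_bound !mulr_ge0 ?invr_ge0 ?exprn_ge0 // ltW.
have tkR : t%:R <= 2 ^+ 12 * k%:R ^+ 2 * q%:R :> R.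
  by move: tk; rewrite -(ler_nat R) !natrM; lra.
rewrite -(ler_nat R) !natrM.
have Nx : (Num.truncn (mv_bound t))%:R <= mv_bound t by rewrite truncn_le.
have main : 2 ^+ 9 * mv_bound t <= t%:R * q%:R ^+ 2; last by lra.
have LL : 0 < L ^+ 4 by rewrite exprn_gt0.
rewrite /mv_bound -/L mulrA ler_pdivrMr // mulrA.
move: (k%:R : R) (q%:R : R) (t%:R : R) kR tkR tR L4 (ler0n R q) => K Q T kR tkR tR L4 Q0.
have h1 : T ^+ 2 <= (2 ^+ 12 * K ^+ 2 * Q) ^+ 2.
  by rewrite ler_pXn2r ?nnegrE ?(le_trans _ tkR) // ltW.
have h2 : K ^+ 4 * Q ^+ 2 <= 16 * L ^+ 4 * Q ^+ 2 by rewrite ler_wpM2r ?exprn_ge0.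
have h3 : T * T ^+ 2 <= T * (2 ^+ 28 * L ^+ 4 * Q ^+ 2).
  by rewrite ler_wpM2l ?(ltW tR) //; apply: le_trans h1 _; lra.
by lra.
Qed.

Lemma cvg_sqrt_ln : (fun t => Num.sqrt (ln (t%:R : R))) t @[t --> \oo] --> +oo.
Proof.
apply/cvgryPge => M.
exists (Num.truncn (expR (M ^+ 2) : R)).+1 => // t /= tM.
have h : expR (M ^+ 2) <= t%:R :> R.
  by apply/ltW; apply: lt_le_trans (truncnS_gt _) _; rewrite ler_nat.
apply: le_trans (ler_norm M) _; rewrite -sqrtr_sqr ler_wsqrtr //.
rewrite -[leLHS](expRK (M ^+ 2)) ler_ln ?posrE ?expR_gt0 //.
exact: lt_le_trans (expR_gt0 _) h.
Qed.

(** From [ln T <= 2 * sqrt T] follows [ln T ^+ 4 <= 16 * T ^+ 2], so the bound is at least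
    [T / 2 ^+ 41]. *)
Lemma mv_bound_ge1 : exists t1 : nat, forall t, (t1 <= t)%N ->
  1 <= ln (t%:R : R) /\ 1 <= mv_bound t.
Proof.
exists (Num.truncn (2 ^+ 41 : R)).+1 => t tt1.
have {tt1} : 2 ^+ 41 <= t%:R :> R.
  by apply/ltW; apply: lt_le_trans (truncnS_gt _) _; rewrite ler_nat.
rewrite /mv_bound; move: (t%:R : R) => T T41; set L := ln T.
have T4 : 2 ^+ 2 <= T by apply: le_trans T41; rewrite ler_eXn2l //; lra.
have T0 : 0 < T by lra.
have L1 : 1 <= L.
  apply: (@le_trans _ _ (ln (2 ^+ 2 : R))); last by rewrite ler_ln ?posrE //; lra.
  by rewrite lnXn // mulr2n; have := ln2_ge_half; lra.
split=> //; pose r := Num.sqrt T.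
have r0 : 0 < r by rewrite sqrtr_gt0.
have rT : T = r ^+ 2 by rewrite sqr_sqrtr // ltW.
have Lr : L <= 2 * r.
  by rewrite /L rT lnXn // mulr2n; have := ln_sublinear r0; lra.
have L4 : L ^+ 4 <= 16 * T ^+ 2.
  have -> : 16 * T ^+ 2 = (2 * r) ^+ 4 by rewrite rT; ring.
  by rewrite ler_pXn2r ?nnegrE //; lra.
have LL : 0 < L ^+ 4 by rewrite exprn_gt0 //; lra.
rewrite ler_pdivlMr // mul1r.
have : 2 ^+ 41 * T ^+ 2 <= T * T ^+ 2 by rewrite ler_wpM2r // exprn_ge0 // ltW.
rewrite ler_pdivlMl ?exprn_gt0 //; lra.
Qed.

(** After taking logarithms, ['C(r, s)] and [F] are compared with s-th powers divided by [s!]. The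
    logarithms of the bases differ by a multiple of the square root of [L = ln t], which the term
    [e * L] absorbs; the remaining [e * ln s!] is at most [e * s * L]. *)
Lemma bin_powR_le (t s r N F : nat) (e : R) :
  (0 < s <= t)%N -> (0 < F)%N -> (r <= 27 * t ^ 3)%N ->
  (N ^ s <= s`! * F)%N -> 1 <= mv_bound t -> mv_bound t < N%:R + 1 ->
  1 <= ln (t%:R : R) -> 0 <= e <= 1 -> e * Num.sqrt (ln t%:R) = 36 ->
  ('C(r, s)%:R : R) `^ (1 - e) <= F%:R.
Proof.
move=> /andP[s0 st] F0 rt NF x1 xN; set L := ln (t%:R : R) => L1 /andP[e0 e1] eS.
have FR : 0 < F%:R :> R by rewrite ltr0n.
(* For a zero binomial the power is 1 if the exponent is 0, and 0 otherwise; both are at most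
   [F]. *)
have [->|y0] := posnP 'C(r, s).
  apply: (@le_trans _ _ 1); last by rewrite ler1n.
  have [->|ne] := eqVneq (1 - e) 0; first by rewrite powRr0.
  by rewrite powR0.
have t0 : (0 < t)%N by apply: leq_trans st.
have tR : 0 < t%:R :> R by rewrite ltr0n.
have yR : 0 < 'C(r, s)%:R :> R by rewrite ltr0n.
have sf : 0 < s`!%:R :> R by rewrite ltr0n fact_gt0.
have sR : 0 < s%:R :> R by rewrite ltr0n.
have N0 : (0 < N)%N.
  by rewrite lt0n; apply: contraTneq xN => ->; rewrite add0r -leNgt.
have NR : 0 < N%:R :> R by rewrite ltr0n.
rewrite /powR gt_eqF // -[leRHS]lnK ?posrE // ler_expR.
pose S := Num.sqrt L.
have S1 : 1 <= S by rewrite -sqrtr1 ler_wsqrtr.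
have LS : L = S ^+ 2 by rewrite sqr_sqrtr //; lra.
have lnL : ln L <= 2 * S.
  rewrite LS lnXn; last by lra.
  have S0 : 0 < S by lra.
  by rewrite mulr2n; have := ln_sublinear S0; lra.
have lny : ln ('C(r, s)%:R : R) + ln (s`!%:R : R) <= s%:R * (ln 27 + 3 * L).
  have h : 'C(r, s)%:R * s`!%:R <= (27 * t%:R ^+ 3) ^+ s :> R.
    have -> : (27 * t%:R ^+ 3) ^+ s = ((27 * t ^ 3) ^ s)%:R :> R.
      by rewrite natrX natrM natrX.
    rewrite -natrM ler_nat bin_ffact.
    by apply: leq_trans (ffact_leq_expn _ _) _; rewrite leq_exp2r.
  move: h; rewrite -ler_ln ?posrE ?mulr_gt0 ?exprn_gt0 ?mulr_gt0 ?exprn_gt0 //.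
  rewrite lnM ?posrE // lnXn ?mulr_gt0 ?exprn_gt0 // lnM ?posrE ?exprn_gt0 //.
  by rewrite lnXn // -/L -[_ *+ s]mulr_natl -[_ *+ 3]mulr_natl.
have lnsf : ln (s`!%:R : R) <= s%:R * L.
  have h : s`!%:R <= t%:R ^+ s :> R.
    by rewrite -natrX ler_nat -ffactnn (leq_trans (ffact_leq_expn _ _)) // leq_exp2r.
  move: h; rewrite -ler_ln ?posrE ?exprn_gt0 // lnXn // -[_ *+ s]mulr_natl //.
have lnF : s%:R * ln (N%:R : R) <= ln (s`!%:R : R) + ln (F%:R : R).
  have h : N%:R ^+ s <= s`!%:R * F%:R :> R by rewrite -natrX -natrM ler_nat.
  move: h; rewrite -ler_ln ?posrE ?exprn_gt0 ?mulr_gt0 // lnXn // lnM ?posrE //.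
  by rewrite -[_ *+ s]mulr_natl.
(* Rounding costs a factor 2, as [mv_bound t < N + 1 <= 2 N]; this turns [2 ^+ 37] into
   [2 ^+ 38]. *)
have lnN : 3 * L - 4 * ln L - 38 * ln 2 <= ln (N%:R : R).
  have L4 : 0 < L ^+ 4 by rewrite exprn_gt0 //; lra.
  have h : t%:R ^+ 3 <= 2 ^+ 38 * (N%:R * L ^+ 4) :> R.
    have : mv_bound t <= 2 * N%:R.
      have : 1 <= N%:R :> R by rewrite ler1n.
      by lra.
    rewrite /mv_bound -/L ler_pdivrMr // ler_pdivrMl ?exprn_gt0 //.
    by lra.
  have NL : 0 < N%:R * L ^+ 4 by rewrite mulr_gt0.
  have p38 : 0 < 2 ^+ 38 :> R by rewrite exprn_gt0.
  have TR : 0 < t%:R ^+ 3 :> R by rewrite exprn_gt0.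
  have Lp : 0 < L by lra.
  move: h; rewrite -ler_ln ?posrE ?(mulr_gt0 p38) //.
  rewrite [ln (_ * (_ * _))]lnM ?posrE // [ln (_%:R * _)]lnM ?posrE //.
  by rewrite !lnXn // -/L; lra.
have ln27 : ln 27 <= 26 :> R.
  have := @le_ln1Dx R 26; rewrite (_ : 1 + 26 = 27); last by lra.
  by apply; lra.
(* The choice of 36: the gain is [2 * e * L = 72 * S], and the losses are [4 * ln L <= 8 * S],
   [ln 27 <= 26] and [38 * ln 2 <= 38], with [8 + 26 + 38 = 72] and [1 <= S]. *)
have key : (1 - e) * (ln 27 + 3 * L) + e * L <= ln (N%:R : R).
  apply: (le_trans _ lnN); have := ln2_le1; have := ln27.
  have eS' : e * S = 36 := eS.
  have eL : e * L = 36 * S by rewrite LS expr2 mulrA eS'.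
  have : e * ln 27 >= 0 by rewrite mulr_ge0 // ln_ge0 //; lra.
  by lra.
have k1 := ler_wpM2l (ltW sR) key.
have k2 : (1 - e) * (ln ('C(r, s)%:R : R) + ln (s`!%:R : R)) <=
   (1 - e) * (s%:R * (ln 27 + 3 * L)) by rewrite ler_wpM2l //; lra.
have k3 : e * ln (s`!%:R : R) <= e * (s%:R * L) by rewrite ler_wpM2l.
move: k1 => /= k1.
by lra.
Qed.
End Asymptotics.

Theorem theorem1p3 (R : realType) :
  (exists (c : R) (t0 : nat), 0 < c /\
     forall t s : nat, (t0 <= t)%N -> (1 <= s <= t)%N ->
       ('C(Num.truncn (c * t%:R ^+ 3 / ln (t%:R : R) ^+ 4), s)
          <= F_ramsey (complete_graph s) 4 t)%N)
  /\
  (exists eps : nat -> R,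
     eps t @[t --> \oo] --> (0 : R) /\
     forall t s : nat, (1 <= s <= t)%N ->
       (('C(ramsey 4 t, s))%:R : R) `^ (1 - eps t)
          <= (F_ramsey (complete_graph s) 4 t)%:R
       /\ (F_ramsey (complete_graph s) 4 t <= 'C(ramsey 4 t, s))%N).
Proof.
have [t0 lower] := F_ramsey_lower_log R; have [t1 large] := mv_bound_ge1 R.
split.
  exists (2 ^+ 37)^-1, t0; split=> [|t s tt st]; first by rewrite invr_gt0 exprn_gt0.
  by have [] := lower t s tt st.
pose S t : R := Num.sqrt (ln t%:R).
pose good t := [&& (t0 <= t)%N, (t1 <= t)%N & 36 / S t <= 1].
(* Where [good] fails the exponent is 0, and the claim reduces to
   [1 <= F_ramsey (complete_graph s) 4 t]. *)
exists (fun t => if good t then 36 / S t else 1); split; last first.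
  move=> t s st; split; last exact: F_ramsey_complete_leq.
  have F0 := F_ramsey_complete_gt0 (isT : (1 < 4)%N) st.
  case: ifP => [/and3P[tt0 tt1 S36]|_]; last by rewrite subrr powRr0 ler1n.
  have [L1 x1] := large t tt1; have [_ NF] := lower t s tt0 st.
  have t_gt0 : (0 < t)%N by case/andP: st => s0; apply: leq_trans.
  have S0 : 0 < S t by rewrite sqrtr_gt0; lra.
  apply: (bin_powR_le st F0 (ramsey4_leq t_gt0) NF x1 _ L1).
  - by have := truncnS_gt (mv_bound R t); rewrite -natr1.
  - by rewrite S36 divr_ge0 // ltW.
  - by rewrite -/(S t) divfK // gt_eqF.
have Sy := @cvg_sqrt_ln R.
have Sgt (M : R) : \forall t \near \oo, M <= S t by move/cvgryPge: Sy; apply.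
have S0 : (S t)^-1 @[t --> \oo] --> (0 : R).
  apply/gtr0_cvgV0 => //; near=> t; apply: (@lt_le_trans _ _ 1) => //.
  by near: t; exact: Sgt.
have : 36 * (S t)^-1 @[t --> \oo] --> (36 * 0 : R) by exact: cvgMr.
rewrite mulr0; apply: cvg_trans; apply: near_eq_cvg; near=> t.
have -> // : good t.
have S36 : 36 <= S t by near: t; exact: Sgt.
apply/and3P; split; [near: t; exact: nbhs_infty_ge | near: t; exact: nbhs_infty_ge |].
by rewrite ler_pdivrMr ?mul1r //; lra.
Unshelve. all: by end_near.
Qed.
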